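(* Let $R$ be a commutative ring, $\sigma\in\mathrm{Aut}(R)$ with $\sigma^p=\mathrm{Id}_R$, $\omega=\{\mathfrak m_0,\dots,\sigma^{p-1}(\mathfrak m_0)\}$ a $\sigma$-orbit in $\mathrm{MaxSpec}(R)$ with $p$ elements, $\Bbbk=R/\mathfrak m_0$, and $t,t'\in R$ regular elements. Let $w=w_1\cdots w_{rp}\in\mathbf D^t_\omega$, $w'=w'_1\cdots w'_{r'p}\in\mathbf D^{t'}_\omega$ with $\gcd(r,r')=d$. Then there is an isomorphism of $A(tt')$-modules $$V^t(\omega,w,x-1)\otimes_RV^{t'}(\omega,w',x-1)\simeq\bigoplus_{j=0}^{d-1}V^{tt'}\big(\omega,\,w\otimes(w'[j]),\,x-t^{w,w'[j]}\,t'^{\,w'[j],w}\big).$$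
   Context: $A(t)$ is the ring generated over $R$ by $X,Y$ with $Xr=\sigma(r)X$, $Yr=\sigma^{-1}(r)Y$ ($r\in R$), $YX=t$, $XY=\sigma(t)$. A weight module is an $A(t)$-module $M=\bigoplus_{\mathfrak m\in\mathrm{MaxSpec}(R)}M_{\mathfrak m}$, $M_{\mathfrak m}=\{v\mid\mathfrak mv=0\}$. For a weight $A(t)$-module $M$ and a weight $A(t')$-module $M'$, $M\otimes_RM'$ is an $A(tt')$-module via $X(v\otimes v')=Xv\otimes Xv'$, $Y(v\otimes v')=Yv\otimes Yv'$. $B^t_\omega=\{\mathfrak m\in\omega\mid t\in\mathfrak m\}$. $\mathbf D^t_\omega$ is the set of indexed words $w=w_jw_{j+1}\cdots w_{j+m}$ with letters $w_k\in\{1,x,y,0\}$ such that $w_k=1$ iff $\sigma^k(\mathfrak m_0)\notin B^t_\omega$. For $w=w_1\cdots w_{rp}\in\mathbf D^t_\omega$ and $\xi\in\Bbbk^\times$, $V^t(\omega,w,x-\xi)=\bigoplus_{1\le k\le rp}(R/\sigma^k(\mathfrak m_0))e_k$ with $Xe_k=\sigma(t)e_{k+1}$ if $k\ne rp,w_k=1$; $e_{k+1}$ if $k\ne rp,w_k=x$; $\sigma(t)\sigma(\xi)e_1$ if $k=rp,w_{rp}=1$; $\sigma(\xi)e_1$ if $k=rp,w_{rp}=x$; $0$ if $w_k\in\{y,0\}$; $Ye_k=e_{k-1}$ if $k\ne1,w_{k-1}\in\{1,y\}$; $\xi^{-1}e_{rp}$ if $k=1,w_{rp}\in\{1,y\}$;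 $0$ if the preceding letter ($w_{k-1}$, or $w_{rp}$ when $k=1$) is in $\{x,0\}$. Here $\sigma(\xi)\in R/\sigma(\mathfrak m_0)$ is the image of $\xi$ under the isomorphism $\Bbbk\to R/\sigma(\mathfrak m_0)$ induced by $\sigma$; $X(rv)=\sigma(r)Xv$, $Y(rv)=\sigma^{-1}(r)Yv$. Word operations. The set $\{0,1,x,y\}$ is a commutative monoid under $a\cdot a=a$, $a\cdot0=0$, $a\cdot1=a$, $x\cdot y=0$. For $w,w'$ of lengths $rp,r'p$ with $d=\gcd(r,r')$: $w\otimes w'=(w_1\cdot w'_1)(w_2\cdot w'_2)\cdots(w_{rr'p/d}\cdot w'_{rr'p/d})\in\mathbf D^{tt'}_\omega$, indices of $w$ mod $rp$ and of $w'$ mod $r'p$. $w[j]=z_1\cdots z_{rp}$ with $z_k=w_{k+jp}$ (indices mod $rp$). For $u\in R$, $$u^{w,w'}=\prod_{\substack{1\le j\le rr'p/d\\ w_j=1,\ w'_j=x}}\sigma^{p+1-j}(u)$$ (indices of $w$ mod $rp$, of $w'$ mod $r'p$). As a scalar in $\Bbbk$, this element is understood by taking its residue class in $R/\sigma(\mathfrak m_0)$ and identifying $R/\sigma(\mathfrak m_0)$ with $\Bbbk=R/\mathfrak m_0$ via $\sigma$; equivalently it is the class in $R/\mathfrak m_0$ of $\prod\sigma^{p-j}(u)$ over the same index set. *)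

(* Defs.v *)
From HB Require Import structures.
From mathcomp Require Import all_boot all_order all_algebra.
From mathcomp Require Import boolp classical_sets cardinality.

Set Implicit Arguments.
Unset Strict Implicit.
Unset Printing Implicit Defensive.

Import GRing.Theory.

Local Open Scope ring_scope.
Local Open Scope quotient_scope.

Record ringAut (R : pzRingType) := RingAut {
  aut_fun :> {rmorphism R -> R};
  aut_inv : R -> R;
  autK : cancel aut_fun aut_inv;
  aut_invK : cancel aut_inv aut_fun }.

Section AutInv.
Variables (R : pzRingType) (s : ringAut R).

HB.instance Definition _ := GRing.isZmodMorphism.Build R R (aut_inv s)
  (can2_zmod_morphism (@autK R s) (@aut_invK R s)).
HB.instance Definition _ := GRing.isMonoidMorphism.Build R R (aut_inv s)
  (can2_monoid_morphism (@autK R s) (@aut_invK R s)).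

Definition autz (z : int) (x : R) : R :=
  match z with
  | Posz n => iter n s x
  | Negz n => iter n.+1 (aut_inv s) x
  end.

Lemma autz_pred (z : int) (x : R) : aut_inv s (autz z x) = autz (z - 1) x.
Proof.
case: z => [[|n]|n] //.
- by have -> : Posz n.+1 - 1 = n by [rewrite -addn1 PoszD addrK]; rewrite /= autK.
- by have -> : Negz n - 1 = Negz n.+1 by rewrite !NegzE -opprD -PoszD addn1.
Qed.

End AutInv.

Section MaxSpec.
Variable R : comNzRingType.

Definition maximal_ideal (I : {pred R}) : Prop :=
  idealr_closed I /\
  forall J : {pred R}, idealr_closed J -> {subset I <= J} -> {subset J <= I}.

Record maxSpec := MaxSpec {
  max_pred :> {pred R};
  max_predP : maximal_ideal max_pred }.

Lemma maxSpec_inj (m n : maxSpec) : max_pred m =i max_pred n -> m = n.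
Proof.
case: m n => [I HI] [J HJ] /= e.
have e' : I = J by apply/funext => x; exact: e x.
by rewrite e' in HI *; congr MaxSpec; exact: Prop_irrelevance.
Qed.

HB.instance Definition _ (m : maxSpec) :=
  isIdealr.Build R (max_pred m) (max_predP m).1.

Lemma maxSpec_bezout (m : maxSpec) (x : R) :
  x \notin m -> exists y, y * x - 1 \in m.
Proof.
move=> xm; pose J := [pred z : R | `[< exists y, z - y * x \in m >]].
apply: contrapT => H.
have Jid : idealr_closed J.
  split.
  - by apply/asboolP; exists 0; rewrite mul0r subr0 rpred0.
  - apply/negP => /asboolP[y Hy]; apply: H; exists y.
    by rewrite -opprB rpredN.
  - move=> a u v /asboolP[y Hy] /asboolP[z Hz]; apply/asboolP.
    exists (a * y + z).
    rewrite mulrDl opprD addrACA -mulrA -mulrBr rpredD //.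
    exact: idealMr.
have mJ : {subset m <= J}.
  by move=> z zm; apply/asboolP; exists 0; rewrite mul0r subr0.
case/negP: xm; apply: ((max_predP m).2 J Jid mJ x).
by apply/asboolP; exists 1; rewrite mul1r subrr rpred0.
Qed.

Lemma maxSpecM (m : maxSpec) (x y : R) :
  (x * y \in m) = (x \in m) || (y \in m).
Proof.
apply/idP/orP => [xym|[xm|ym]]; last exact: idealMr; last first.
  by rewrite mulrC; exact: idealMr.
have [xm|/maxSpec_bezout[z zm]] := boolP (x \in m); [by left|right].
have -> : y = z * (x * y) - y * (z * x - 1).
  by rewrite mulrBr mulr1 [y * _]mulrC -mulrA subKr.
by rewrite rpredB // idealMr.
Qed.

Definition resfield (m : maxSpec) : Type := {ideal_quot (max_pred m)}.

Section ResField.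
Variable m : maxSpec.

HB.instance Definition _ := GRing.ComNzRing.on (resfield m).

Definition rescl (x : R) : resfield m := \pi_{ideal_quot (max_pred m)} x.
Definition resrep (x : resfield m) : R :=
  repr (x : {ideal_quot (max_pred m)}).

Lemma resrepK x : rescl (resrep x) = x.
Proof. exact: reprK. Qed.

Lemma rescl_is_zmod_morphism : zmod_morphism rescl.
Proof. by move=> x y; rewrite /rescl !piE. Qed.

Lemma rescl_is_monoid_morphism : monoid_morphism rescl.
Proof. by split=> [|x y]; rewrite /rescl !piE. Qed.

HB.instance Definition _ :=
  GRing.isZmodMorphism.Build R (resfield m) rescl rescl_is_zmod_morphism.
HB.instance Definition _ :=
  GRing.isMonoidMorphism.Build R (resfield m) rescl rescl_is_monoid_morphism.

Lemma rescl_eq0 x : (rescl x == 0) = (x \in m).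
Proof.
have := Quotient.idealrBE (max_pred m) x 0; rewrite subr0 => ->.
by rewrite -/(rescl x) -/(rescl 0) rmorph0.
Qed.

Lemma resfield_ex_inv (x : resfield m) : exists y, (x == 0) || (y * x == 1).
Proof.
have [x0|x0] := eqVneq x 0; first by exists 0.
have : resrep x \notin m by rewrite -rescl_eq0 resrepK.
case/maxSpec_bezout => y; rewrite -rescl_eq0 rmorphB rmorphM rmorph1 /= resrepK.
by rewrite subr_eq0 => H; exists (rescl y).
Qed.

Definition resfield_inv (x : resfield m) : resfield m :=
  if x == 0 then 0 else xchoose (resfield_ex_inv x).

Lemma resfield_mulVf x : x != 0 -> resfield_inv x * x = 1.
Proof.
rewrite /resfield_inv; case: ifPn => // x0 _.
have /orP[x0'|/eqP//] := xchooseP (resfield_ex_inv x).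
by rewrite x0' in x0.
Qed.

Lemma resfield_inv0 : resfield_inv 0 = 0.
Proof. by rewrite /resfield_inv; case: ifPn => // /eqP[]. Qed.

HB.instance Definition _ :=
  GRing.ComNzRing_isField.Build (resfield m) resfield_mulVf resfield_inv0.

Definition resfield_scale (r : R) (x : resfield m) : resfield m := rescl r * x.

Lemma resfield_scalerA a b x :
  resfield_scale a (resfield_scale b x) = resfield_scale (a * b) x.
Proof. by rewrite /resfield_scale rmorphM mulrA. Qed.
Lemma resfield_scale1r : left_id 1 resfield_scale.
Proof. by move=> x; rewrite /resfield_scale rmorph1 mul1r. Qed.
Lemma resfield_scalerDr : right_distributive resfield_scale +%R.
Proof. by move=> r x y; rewrite /resfield_scale mulrDr. Qed.
Lemma resfield_scalerDl x : {morph resfield_scale^~ x : a b / a + b}.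
Proof. by move=> a b; rewrite /resfield_scale rmorphD mulrDl. Qed.

HB.instance Definition _ := GRing.Zmodule_isLmodule.Build R (resfield m)
  resfield_scalerA resfield_scale1r resfield_scalerDr resfield_scalerDl.

Lemma resfield_scaleE (r : R) (x : resfield m) : r *: x = rescl r * x.
Proof. by []. Qed.

End ResField.

Definition kunit (m : maxSpec) := {x : resfield m | x != 0}.

Definition kunit1 (m : maxSpec) : kunit m :=
  exist (fun x : resfield m => x != 0) 1 (oner_neq0 (resfield m)).

End MaxSpec.

Section AutMax.
Variables (R : comNzRingType) (s : ringAut R).

(* [aut_inv s x \in m] says that x lies in the direct image of m under s. *)
Lemma aut_max_subproof (m : maxSpec R) :
  maximal_ideal [pred x : R | aut_inv s x \in m].
Proof.
split.
  split; rewrite ?inE ?rmorph0 ?rmorph1 ?rpred0 //.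
    by have [_ -> _] := (max_predP m).1.
  move=> a u v; rewrite !inE => um vm.
  by rewrite rmorphD rmorphM rpredD // idealMr.
move=> J [J0 J1 JD] mJ x xJ; rewrite inE.
apply: ((max_predP m).2 [pred y | s y \in J]).
- split; rewrite ?inE ?rmorph0 ?rmorph1 // => a u v.
  by rewrite !inE rmorphD rmorphM; exact: JD.
- by move=> y ym; rewrite inE; apply: mJ; rewrite inE autK.
- by rewrite inE aut_invK.
Qed.

Definition aut_max (m : maxSpec R) : maxSpec R := MaxSpec (aut_max_subproof m).

Lemma mem_aut_max k m x :
  (x \in iter k aut_max m) = (iter k (aut_inv s) x \in m).
Proof. by elim: k x => [|k IH] x //; rewrite iterS iterSr -IH. Qed.

End AutMax.

Definition dsum (I : finType) (V : I -> Type) : Type := {dffun forall i, V i}.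

Section DSumZmod.
Variables (I : finType) (V : I -> zmodType).

HB.instance Definition _ := Choice.copy (dsum V) {dffun forall i, V i}.

Definition dsum0 : dsum V := [ffun i => 0 : V i].
Definition dsumN (f : dsum V) : dsum V := [ffun i => - f i].
Definition dsumD (f g : dsum V) : dsum V := [ffun i => f i + g i].

Lemma dsumDA : associative dsumD.
Proof. by move=> f g h; apply/ffunP => i; rewrite !ffunE addrA. Qed.
Lemma dsumDC : commutative dsumD.
Proof. by move=> f g; apply/ffunP => i; rewrite !ffunE addrC. Qed.
Lemma dsum0D : left_id dsum0 dsumD.
Proof. by move=> f; apply/ffunP => i; rewrite !ffunE add0r. Qed.
Lemma dsumND : left_inverse dsum0 dsumN dsumD.
Proof. by move=> f; apply/ffunP => i; rewrite !ffunE addNr. Qed.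

HB.instance Definition _ :=
  GRing.isZmodule.Build (dsum V) dsumDA dsumDC dsum0D dsumND.

Lemma dsum0E i : (0 : dsum V) i = 0.
Proof. by rewrite ffunE. Qed.
Lemma dsumDE (f g : dsum V) i : (f + g) i = f i + g i.
Proof. by rewrite ffunE. Qed.
Lemma dsumNE (f : dsum V) i : (- f) i = - f i.
Proof. by rewrite ffunE. Qed.
Lemma dsum_sumE (J : Type) (r : seq J) (P : pred J) (F : J -> dsum V) i :
  (\sum_(j <- r | P j) F j) i = \sum_(j <- r | P j) F j i.
Proof.
elim: r => [|j r IH]; first by rewrite !big_nil dsum0E.
by rewrite !big_cons; case: (P j); rewrite ?dsumDE IH.
Qed.

End DSumZmod.

Section DSumLmod.
Variables (A : pzRingType) (I : finType) (V : I -> lmodType A).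

Definition dsumZ (a : A) (f : dsum V) : dsum V := [ffun i => a *: f i].

Lemma dsumZA a b f : dsumZ a (dsumZ b f) = dsumZ (a * b) f.
Proof. by apply/ffunP => i; rewrite !ffunE scalerA. Qed.
Lemma dsumZ1 : left_id 1 dsumZ.
Proof. by move=> f; apply/ffunP => i; rewrite !ffunE scale1r. Qed.
Lemma dsumZDr : right_distributive dsumZ +%R.
Proof. by move=> a f g; apply/ffunP => i; rewrite !ffunE scalerDr. Qed.
Lemma dsumZDl f : {morph dsumZ^~ f : a b / a + b}.
Proof. by move=> a b; apply/ffunP => i; rewrite !ffunE scalerDl. Qed.

HB.instance Definition _ :=
  GRing.Zmodule_isLmodule.Build A (dsum V) dsumZA dsumZ1 dsumZDr dsumZDl.

Lemma dsumZE a (f : dsum V) i : (a *: f) i = a *: f i.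
Proof. by rewrite ffunE. Qed.

End DSumLmod.

(* A(t) is the quotient of the formal ring expressions in X, Y and constants  *)
(* from R by gwa_eq, the least congruence that satisfies the ring axioms,     *)
(* makes R -> A(t) a ring morphism and contains the four relations            *)
(* X r = sigma(r) X, Y r = sigma^-1(r) Y, YX = t, XY = sigma(t).              *)
Inductive gwa_term (R : Type) : Type :=
  | GC of R | GX | GY
  | GOpp of gwa_term R
  | GAdd of gwa_term R & gwa_term R
  | GMul of gwa_term R & gwa_term R.
Arguments GX {R}.
Arguments GY {R}.

HB.instance Definition _ (R : Type) := gen_eqMixin (gwa_term R).
HB.instance Definition _ (R : Type) := gen_choiceMixin (gwa_term R).

Section GWA.
Variables (R : comNzRingType) (s : ringAut R) (t : R).

Inductive gwa_eq : gwa_term R -> gwa_term R -> Prop :=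
  | gwa_refl a : gwa_eq a a
  | gwa_sym a b : gwa_eq a b -> gwa_eq b a
  | gwa_trans a b c : gwa_eq a b -> gwa_eq b c -> gwa_eq a c
  | gwa_congN a a' : gwa_eq a a' -> gwa_eq (GOpp a) (GOpp a')
  | gwa_congD a a' b b' :
      gwa_eq a a' -> gwa_eq b b' -> gwa_eq (GAdd a b) (GAdd a' b')
  | gwa_congM a a' b b' :
      gwa_eq a a' -> gwa_eq b b' -> gwa_eq (GMul a b) (GMul a' b')
  | gwa_addA a b c : gwa_eq (GAdd a (GAdd b c)) (GAdd (GAdd a b) c)
  | gwa_addC a b : gwa_eq (GAdd a b) (GAdd b a)
  | gwa_add0 a : gwa_eq (GAdd (GC 0) a) a
  | gwa_addN a : gwa_eq (GAdd (GOpp a) a) (GC 0)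
  | gwa_mulA a b c : gwa_eq (GMul a (GMul b c)) (GMul (GMul a b) c)
  | gwa_mul1l a : gwa_eq (GMul (GC 1) a) a
  | gwa_mul1r a : gwa_eq (GMul a (GC 1)) a
  | gwa_mulDl a b c : gwa_eq (GMul (GAdd a b) c) (GAdd (GMul a c) (GMul b c))
  | gwa_mulDr a b c : gwa_eq (GMul a (GAdd b c)) (GAdd (GMul a b) (GMul a c))
  | gwa_CD r r' : gwa_eq (GC (r + r')) (GAdd (GC r) (GC r'))
  | gwa_CM r r' : gwa_eq (GC (r * r')) (GMul (GC r) (GC r'))
  | gwa_Xr r : gwa_eq (GMul GX (GC r)) (GMul (GC (s r)) GX)
  | gwa_Yr r : gwa_eq (GMul GY (GC r)) (GMul (GC (aut_inv s r)) GY)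
  | gwa_YX : gwa_eq (GMul GY GX) (GC t)
  | gwa_XY : gwa_eq (GMul GX GY) (GC (s t)).

Definition gwa_eqb : rel (gwa_term R) := fun a b => `[< gwa_eq a b >].

Lemma gwa_eqb_equiv : equiv_class_of gwa_eqb.
Proof.
split=> [a|a b|b a c].
- by apply/asboolP; exact: gwa_refl.
- by apply/asboolP/asboolP; exact: gwa_sym.
- move=> /asboolP ab /asboolP bc; apply/asboolP; exact: gwa_trans ab bc.
Qed.

Canonical gwa_equiv := EquivRelPack gwa_eqb_equiv.
Canonical gwa_encModRel := defaultEncModRel gwa_eqb.

Definition gwa : Type := {eq_quot gwa_eqb}.
HB.instance Definition _ := Choice.on gwa.

Definition gwa_cl (a : gwa_term R) : gwa := \pi_{eq_quot gwa_eqb} a.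
Definition gwa_rep (x : gwa) : gwa_term R := repr (x : {eq_quot gwa_eqb}).

Lemma gwa_repK x : gwa_cl (gwa_rep x) = x.
Proof. exact: reprK. Qed.

Lemma gwa_clP a b : gwa_cl a = gwa_cl b <-> gwa_eq a b.
Proof.
split=> [/eqP|ab]; last apply/eqP.
  by rewrite piE => /asboolP.
by rewrite piE; apply/asboolP.
Qed.

Lemma gwa_rep_cl a : gwa_eq (gwa_rep (gwa_cl a)) a.
Proof. by apply/gwa_clP; rewrite gwa_repK. Qed.

Definition gwa_zero : gwa := gwa_cl (GC 0).
Definition gwa_one : gwa := gwa_cl (GC 1).
Definition gwa_opp (x : gwa) : gwa := gwa_cl (GOpp (gwa_rep x)).
Definition gwa_add (x y : gwa) : gwa := gwa_cl (GAdd (gwa_rep x) (gwa_rep y)).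
Definition gwa_mul (x y : gwa) : gwa := gwa_cl (GMul (gwa_rep x) (gwa_rep y)).

Lemma gwa_oppE a : gwa_opp (gwa_cl a) = gwa_cl (GOpp a).
Proof. by apply/gwa_clP/gwa_congN/gwa_rep_cl. Qed.
Lemma gwa_addE a b : gwa_add (gwa_cl a) (gwa_cl b) = gwa_cl (GAdd a b).
Proof. by apply/gwa_clP/gwa_congD; exact: gwa_rep_cl. Qed.
Lemma gwa_mulE a b : gwa_mul (gwa_cl a) (gwa_cl b) = gwa_cl (GMul a b).
Proof. by apply/gwa_clP/gwa_congM; exact: gwa_rep_cl. Qed.

Lemma gwa_ind (P : gwa -> Prop) : (forall a, P (gwa_cl a)) -> forall x, P x.
Proof. by move=> H x; rewrite -[x]gwa_repK. Qed.

Let gwaE := (gwa_oppE, gwa_addE, gwa_mulE).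

Fact gwa_qaddA : associative gwa_add.
Proof.
by elim/gwa_ind=> a; elim/gwa_ind=> b; elim/gwa_ind=> c;
   rewrite !gwaE; apply/gwa_clP/gwa_addA.
Qed.
Fact gwa_qaddC : commutative gwa_add.
Proof.
by elim/gwa_ind=> a; elim/gwa_ind=> b; rewrite !gwaE; apply/gwa_clP/gwa_addC.
Qed.
Fact gwa_qadd0 : left_id gwa_zero gwa_add.
Proof. by elim/gwa_ind=> a; rewrite !gwaE; apply/gwa_clP/gwa_add0. Qed.
Fact gwa_qaddN : left_inverse gwa_zero gwa_opp gwa_add.
Proof. by elim/gwa_ind=> a; rewrite !gwaE; apply/gwa_clP/gwa_addN. Qed.

HB.instance Definition _ :=
  GRing.isZmodule.Build gwa gwa_qaddA gwa_qaddC gwa_qadd0 gwa_qaddN.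

Fact gwa_qmulA : associative gwa_mul.
Proof.
by elim/gwa_ind=> a; elim/gwa_ind=> b; elim/gwa_ind=> c;
   rewrite !gwaE; apply/gwa_clP/gwa_mulA.
Qed.
Fact gwa_qmul1l : left_id gwa_one gwa_mul.
Proof. by elim/gwa_ind=> a; rewrite !gwaE; apply/gwa_clP/gwa_mul1l. Qed.
Fact gwa_qmul1r : right_id gwa_one gwa_mul.
Proof. by elim/gwa_ind=> a; rewrite !gwaE; apply/gwa_clP/gwa_mul1r. Qed.
Fact gwa_qmulDl : left_distributive gwa_mul +%R.
Proof.
by elim/gwa_ind=> a; elim/gwa_ind=> b; elim/gwa_ind=> c;
   rewrite /+%R /= !gwaE; apply/gwa_clP/gwa_mulDl.
Qed.
Fact gwa_qmulDr : right_distributive gwa_mul +%R.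
Proof.
by elim/gwa_ind=> a; elim/gwa_ind=> b; elim/gwa_ind=> c;
   rewrite /+%R /= !gwaE; apply/gwa_clP/gwa_mulDr.
Qed.

HB.instance Definition _ := GRing.Zmodule_isPzRing.Build gwa
  gwa_qmulA gwa_qmul1l gwa_qmul1r gwa_qmulDl gwa_qmulDr.

Lemma gwa_clN a : gwa_cl (GOpp a) = - gwa_cl a.
Proof. by rewrite -gwa_oppE. Qed.
Lemma gwa_clD a b : gwa_cl (GAdd a b) = gwa_cl a + gwa_cl b.
Proof. by rewrite -gwa_addE. Qed.
Lemma gwa_clM a b : gwa_cl (GMul a b) = gwa_cl a * gwa_cl b.
Proof. by rewrite -gwa_mulE. Qed.

Definition gwaC (r : R) : gwa := gwa_cl (GC r).
Definition gwaX : gwa := gwa_cl GX.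
Definition gwaY : gwa := gwa_cl GY.

Fact gwaC_is_zmod_morphism : zmod_morphism gwaC.
Proof.
have D r r' : gwaC (r + r') = gwaC r + gwaC r'.
  by rewrite /gwaC -gwa_clD; apply/gwa_clP/gwa_CD.
move=> r r'; apply: (addIr (gwaC r')).
by rewrite -D !subrK.
Qed.
Fact gwaC_is_monoid_morphism : monoid_morphism gwaC.
Proof.
by split=> // r r'; rewrite /gwaC -gwa_clM; apply/gwa_clP/gwa_CM.
Qed.
HB.instance Definition _ :=
  GRing.isZmodMorphism.Build R gwa gwaC gwaC_is_zmod_morphism.
HB.instance Definition _ :=
  GRing.isMonoidMorphism.Build R gwa gwaC gwaC_is_monoid_morphism.

Lemma gwaXC r : gwaX * gwaC r = gwaC (s r) * gwaX.
Proof. by rewrite -!gwa_clM; apply/gwa_clP/gwa_Xr. Qed.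
Lemma gwaYC r : gwaY * gwaC r = gwaC (aut_inv s r) * gwaY.
Proof. by rewrite -!gwa_clM; apply/gwa_clP/gwa_Yr. Qed.
Lemma gwaYX : gwaY * gwaX = gwaC t.
Proof. by rewrite -!gwa_clM; apply/gwa_clP/gwa_YX. Qed.
Lemma gwaXY : gwaX * gwaY = gwaC (s t).
Proof. by rewrite -!gwa_clM; apply/gwa_clP/gwa_XY. Qed.

(* An A(t)-module regarded as an R-module by restriction of scalars. *)
Definition gwa_restr (M : lmodType gwa) : Type := M.

Section Restr.
Variable M : lmodType gwa.
HB.instance Definition _ := GRing.Zmodule.copy (gwa_restr M) M.

Definition restr_scale (r : R) (v : gwa_restr M) : gwa_restr M :=
  gwaC r *: (v : M).

Fact restr_scalerA a b v :
  restr_scale a (restr_scale b v) = restr_scale (a * b) v.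
Proof. by rewrite /restr_scale scalerA -rmorphM. Qed.
Fact restr_scale1r : left_id 1 restr_scale.
Proof. by move=> v; rewrite /restr_scale rmorph1 scale1r. Qed.
Fact restr_scalerDr : right_distributive restr_scale +%R.
Proof. by move=> a u v; rewrite /restr_scale scalerDr. Qed.
Fact restr_scalerDl v : {morph restr_scale^~ v : a b / a + b}.
Proof. by move=> a b; rewrite /restr_scale rmorphD scalerDl. Qed.
HB.instance Definition _ := GRing.Zmodule_isLmodule.Build R (gwa_restr M)
  restr_scalerA restr_scale1r restr_scalerDr restr_scalerDl.

Lemma restr_scaleE (r : R) (v : gwa_restr M) : r *: v = gwaC r *: (v : M).
Proof. by []. Qed.

End Restr.

(* The A(t)-module structure on an R-module given by the actions of X and Y. *)
Record gwa_action (M : lmodType R) := GwaAction {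
  actX : M -> M;
  actY : M -> M;
  actXD : {morph actX : u v / u + v};
  actYD : {morph actY : u v / u + v};
  actXZ : forall r v, actX (r *: v) = s r *: actX v;
  actYZ : forall r v, actY (r *: v) = aut_inv s r *: actY v;
  actYX : forall v, actY (actX v) = t *: v;
  actXY : forall v, actX (actY v) = s t *: v }.

Definition gwa_module (M : lmodType R) of gwa_action M : Type := M.

Section GwaModule.
Variables (M : lmodType R) (act : gwa_action M).

HB.instance Definition _ := GRing.Zmodule.copy (gwa_module act) M.

Fixpoint gwa_eval (a : gwa_term R) (v : M) : M :=
  match a with
  | GC r => r *: v
  | GX => actX act v
  | GY => actY act v
  | GOpp a => - gwa_eval a v
  | GAdd a b => gwa_eval a v + gwa_eval b v
  | GMul a b => gwa_eval a (gwa_eval b v)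
  end.

Lemma gwa_evalD a : {morph gwa_eval a : u v / u + v}.
Proof.
elim: a => [r|||a IH|a IHa b IHb|a IHa b IHb] u v /=.
- exact: scalerDr.
- exact: actXD.
- exact: actYD.
- by rewrite IH opprD.
- by rewrite IHa IHb addrACA.
- by rewrite IHb IHa.
Qed.

Lemma gwa_evalP a b : gwa_eq a b -> forall v, gwa_eval a v = gwa_eval b v.
Proof.
elim=> {a b} /= [a|a b _ IH|a b c _ IH1 _ IH2|a b _ IH
  |a a' b b' _ IH1 _ IH2|a a' b b' _ IH1 _ IH2|a b c|a b|a|a|a b c|a|a|a b c
  |a b c|r r'|r r'|r|r||] v //.
- by rewrite IH1.
- by rewrite IH.
- by rewrite IH1 IH2.
- by rewrite IH1 IH2.
- by rewrite addrA.
- by rewrite addrC.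
- by rewrite scale0r add0r.
- by rewrite scale0r addNr.
- by rewrite scale1r.
- by rewrite scale1r.
- by rewrite gwa_evalD.
- by rewrite scalerDl.
- by rewrite scalerA.
- by rewrite actXZ.
- by rewrite actYZ.
- by rewrite actYX.
- by rewrite actXY.
Qed.

Definition gwa_mod_scale (x : gwa) (v : gwa_module act) : gwa_module act :=
  gwa_eval (gwa_rep x) v.

Lemma gwa_mod_scale_cl a v : gwa_mod_scale (gwa_cl a) v = gwa_eval a v.
Proof. exact/gwa_evalP/gwa_rep_cl. Qed.

Fact gwa_mod_scalerA a b v :
  gwa_mod_scale a (gwa_mod_scale b v) = gwa_mod_scale (a * b) v.
Proof.
by elim/gwa_ind: a => a; elim/gwa_ind: b => b; rewrite -gwa_clM !gwa_mod_scale_cl.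
Qed.
Fact gwa_mod_scale1r : left_id 1 gwa_mod_scale.
Proof. by move=> v; rewrite gwa_mod_scale_cl /= scale1r. Qed.
Fact gwa_mod_scalerDr : right_distributive gwa_mod_scale +%R.
Proof. by move=> a u v; exact: gwa_evalD. Qed.
Fact gwa_mod_scalerDl v : {morph gwa_mod_scale^~ v : a b / a + b}.
Proof.
by elim/gwa_ind => a; elim/gwa_ind => b; rewrite -gwa_clD !gwa_mod_scale_cl.
Qed.

HB.instance Definition _ := GRing.Zmodule_isLmodule.Build gwa (gwa_module act)
  gwa_mod_scalerA gwa_mod_scale1r gwa_mod_scalerDr gwa_mod_scalerDl.

Lemma gwa_moduleC r (v : gwa_module act) : gwaC r *: v = (r *: (v : M)).
Proof. exact: gwa_mod_scale_cl. Qed.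
Lemma gwa_moduleX (v : gwa_module act) : gwaX *: v = actX act v.
Proof. exact: gwa_mod_scale_cl. Qed.
Lemma gwa_moduleY (v : gwa_module act) : gwaY *: v = actY act v.
Proof. exact: gwa_mod_scale_cl. Qed.

End GwaModule.

End GWA.

(* M (x)_R N is the abelian group generated by the symbols TPure m n, i.e.    *)
(* m (x) n, modulo the congruence tens_eq below; R acts by                    *)
(* r (m (x) n) = (r m) (x) n.                                                 *)
Inductive tens_term (M N : Type) : Type :=
  | TPure of M & N
  | TZero
  | TOpp of tens_term M N
  | TAdd of tens_term M N & tens_term M N.
Arguments TZero {M N}.

HB.instance Definition _ (M N : Type) := gen_eqMixin (tens_term M N).
HB.instance Definition _ (M N : Type) := gen_choiceMixin (tens_term M N).

Section Tensor.
Variables (R : comNzRingType) (M N : lmodType R).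

Inductive tens_eq : tens_term M N -> tens_term M N -> Prop :=
  | tens_refl a : tens_eq a a
  | tens_sym a b : tens_eq a b -> tens_eq b a
  | tens_trans a b c : tens_eq a b -> tens_eq b c -> tens_eq a c
  | tens_congN a a' : tens_eq a a' -> tens_eq (TOpp a) (TOpp a')
  | tens_congD a a' b b' :
      tens_eq a a' -> tens_eq b b' -> tens_eq (TAdd a b) (TAdd a' b')
  | tens_addA a b c : tens_eq (TAdd a (TAdd b c)) (TAdd (TAdd a b) c)
  | tens_addC a b : tens_eq (TAdd a b) (TAdd b a)
  | tens_add0 a : tens_eq (TAdd TZero a) a
  | tens_addN a : tens_eq (TAdd (TOpp a) a) TZero
  | tens_pureDl m m' n :
      tens_eq (TPure (m + m') n) (TAdd (TPure m n) (TPure m' n))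
  | tens_pureDr m n n' :
      tens_eq (TPure m (n + n')) (TAdd (TPure m n) (TPure m n'))
  | tens_pureZ r m n : tens_eq (TPure (r *: m) n) (TPure m (r *: n)).

Definition tens_eqb : rel (tens_term M N) := fun a b => `[< tens_eq a b >].

Lemma tens_eqb_equiv : equiv_class_of tens_eqb.
Proof.
split=> [a|a b|b a c].
- by apply/asboolP; exact: tens_refl.
- by apply/asboolP/asboolP; exact: tens_sym.
- move=> /asboolP ab /asboolP bc; apply/asboolP; exact: tens_trans ab bc.
Qed.

Canonical tens_equiv := EquivRelPack tens_eqb_equiv.
Canonical tens_encModRel := defaultEncModRel tens_eqb.

Definition tensor : Type := {eq_quot tens_eqb}.
HB.instance Definition _ := Choice.on tensor.

Definition tens_cl (a : tens_term M N) : tensor := \pi_{eq_quot tens_eqb} a.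
Definition tens_rep (x : tensor) : tens_term M N :=
  repr (x : {eq_quot tens_eqb}).

Lemma tens_repK x : tens_cl (tens_rep x) = x.
Proof. exact: reprK. Qed.

Lemma tens_clP a b : tens_cl a = tens_cl b <-> tens_eq a b.
Proof.
split=> [/eqP|ab]; last apply/eqP.
  by rewrite piE => /asboolP.
by rewrite piE; apply/asboolP.
Qed.

Lemma tens_rep_cl a : tens_eq (tens_rep (tens_cl a)) a.
Proof. by apply/tens_clP; rewrite tens_repK. Qed.

Definition tens_zero : tensor := tens_cl TZero.
Definition tens_opp (x : tensor) : tensor := tens_cl (TOpp (tens_rep x)).
Definition tens_add (x y : tensor) : tensor :=
  tens_cl (TAdd (tens_rep x) (tens_rep y)).

Lemma tens_oppE a : tens_opp (tens_cl a) = tens_cl (TOpp a).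
Proof. by apply/tens_clP/tens_congN/tens_rep_cl. Qed.
Lemma tens_addE a b : tens_add (tens_cl a) (tens_cl b) = tens_cl (TAdd a b).
Proof. by apply/tens_clP/tens_congD; exact: tens_rep_cl. Qed.

Lemma tens_cl_ind (P : tensor -> Prop) :
  (forall a, P (tens_cl a)) -> forall x, P x.
Proof. by move=> H x; rewrite -[x]tens_repK. Qed.

Let tensE := (tens_oppE, tens_addE).

Fact tens_qaddA : associative tens_add.
Proof.
by elim/tens_cl_ind=> a; elim/tens_cl_ind=> b; elim/tens_cl_ind=> c;
   rewrite !tensE; apply/tens_clP/tens_addA.
Qed.
Fact tens_qaddC : commutative tens_add.
Proof.
by elim/tens_cl_ind=> a; elim/tens_cl_ind=> b;
   rewrite !tensE; apply/tens_clP/tens_addC.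
Qed.
Fact tens_qadd0 : left_id tens_zero tens_add.
Proof. by elim/tens_cl_ind=> a; rewrite !tensE; apply/tens_clP/tens_add0. Qed.
Fact tens_qaddN : left_inverse tens_zero tens_opp tens_add.
Proof. by elim/tens_cl_ind=> a; rewrite !tensE; apply/tens_clP/tens_addN. Qed.

HB.instance Definition _ :=
  GRing.isZmodule.Build tensor tens_qaddA tens_qaddC tens_qadd0 tens_qaddN.

Definition tens (m : M) (n : N) : tensor := tens_cl (TPure m n).

Lemma tensDl m m' n : tens (m + m') n = tens m n + tens m' n.
Proof. by rewrite /+%R /= tens_addE; apply/tens_clP/tens_pureDl. Qed.
Lemma tensDr m n n' : tens m (n + n') = tens m n + tens m n'.
Proof. by rewrite /+%R /= tens_addE; apply/tens_clP/tens_pureDr. Qed.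
Lemma tensZ r m n : tens (r *: m) n = tens m (r *: n).
Proof. exact/tens_clP/tens_pureZ. Qed.

Lemma tens_ind (P : tensor -> Prop) :
  (forall m n, P (tens m n)) -> P 0 -> (forall x, P x -> P (- x)) ->
  (forall x y, P x -> P y -> P (x + y)) -> forall x, P x.
Proof.
move=> Pp P0 PN PD; elim/tens_cl_ind.
elim=> [m n||a IH|a IHa b IHb] //; first exact: Pp.
  by rewrite -tens_oppE; exact: PN.
by rewrite -tens_addE; exact: PD.
Qed.

Record balanced (P : zmodType) (f : M -> N -> P) : Prop := Balanced {
  balDl : forall m m' n, f (m + m') n = f m n + f m' n;
  balDr : forall m n n', f m (n + n') = f m n + f m n';
  balZ : forall r m n, f (r *: m) n = f m (r *: n) }.

Section Lift.
Variables (P : zmodType) (f : M -> N -> P) (bf : balanced f).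

Fixpoint tens_eval (a : tens_term M N) : P :=
  match a with
  | TPure m n => f m n
  | TZero => 0
  | TOpp a => - tens_eval a
  | TAdd a b => tens_eval a + tens_eval b
  end.

Lemma tens_evalP a b : tens_eq a b -> tens_eval a = tens_eval b.
Proof.
elim=> {a b} /= [a|a b _ ->|a b c _ -> _ ->|a b _ ->|a a' b b' _ -> _ ->
  |a b c|a b|a|a|m m' n|m n n'|r m n] //.
- exact: addrA.
- exact: addrC.
- exact: add0r.
- exact: addNr.
- exact: balDl.
- exact: balDr.
- exact: balZ.
Qed.

Definition tens_lift of balanced f := fun x : tensor => tens_eval (tens_rep x).

Lemma tens_liftE m n : tens_lift bf (tens m n) = f m n.
Proof. exact: (tens_evalP (tens_rep_cl (TPure m n))). Qed.

Fact tens_lift_is_zmod_morphism : zmod_morphism (tens_lift bf).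
Proof.
elim/tens_cl_ind=> a; elim/tens_cl_ind=> b.
rewrite {1}/GRing.add {1}/GRing.opp /= tens_oppE tens_addE.
by rewrite /tens_lift !(tens_evalP (tens_rep_cl _)).
Qed.

HB.instance Definition _ := GRing.isZmodMorphism.Build tensor P (tens_lift bf)
  tens_lift_is_zmod_morphism.

End Lift.

Lemma tens_hom_ext (P : zmodType) (f g : {additive tensor -> P}) :
  (forall m n, f (tens m n) = g (tens m n)) -> f =1 g.
Proof.
move=> fg; elim/tens_ind => [m n||x IH|x y IHx IHy]; first exact: fg.
- by rewrite !raddf0.
- by rewrite !raddfN IH.
- by rewrite !raddfD IHx IHy.
Qed.

Lemma tens_scale_balanced (r : R) : balanced (fun m n => tens (r *: m) n).
Proof.
split=> [m m' n|m n n'|r' m n].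
- by rewrite scalerDr tensDl.
- exact: tensDr.
- by rewrite scalerA mulrC -scalerA tensZ.
Qed.

Definition tens_scale (r : R) : tensor -> tensor :=
  tens_lift (tens_scale_balanced r).

Lemma tens_scaleE r m n : tens_scale r (tens m n) = tens (r *: m) n.
Proof. exact: tens_liftE. Qed.

Fact tens_scalerDr : right_distributive tens_scale +%R.
Proof. by move=> r x y; rewrite /tens_scale raddfD. Qed.
Fact tens_scalerA a b x : tens_scale a (tens_scale b x) = tens_scale (a * b) x.
Proof.
elim/tens_ind: x => [m n||x IH|x y IHx IHy].
- by rewrite !tens_scaleE scalerA.
- by rewrite /tens_scale !raddf0.
- by rewrite /tens_scale !raddfN; congr (- _).
- by rewrite !tens_scalerDr IHx IHy.
Qed.
Fact tens_scale1r : left_id 1 tens_scale.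
Proof.
elim/tens_ind => [m n||x IH|x y IHx IHy].
- by rewrite !tens_scaleE scale1r.
- by rewrite /tens_scale !raddf0.
- by rewrite /tens_scale !raddfN; congr (- _).
- by rewrite !tens_scalerDr IHx IHy.
Qed.
Fact tens_scalerDl x : {morph tens_scale^~ x : a b / a + b}.
Proof.
move=> a b; elim/tens_ind: x => [m n||x IH|x y IHx IHy].
- by rewrite !tens_scaleE scalerDl tensDl.
- by rewrite /tens_scale !raddf0 addr0.
- by rewrite /tens_scale !raddfN -opprD; congr (- _).
- by rewrite !tens_scalerDr IHx IHy addrACA.
Qed.

HB.instance Definition _ := GRing.Zmodule_isLmodule.Build R tensor
  tens_scalerA tens_scale1r tens_scalerDr tens_scalerDl.

Lemma tensZl r m n : r *: tens m n = tens (r *: m) n.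
Proof. exact: tens_scaleE. Qed.
Lemma tensZr r m n : r *: tens m n = tens m (r *: n).
Proof. by rewrite tensZl tensZ. Qed.

End Tensor.

Section TensorGwa.
Variables (R : comNzRingType) (s : ringAut R) (t t' : R).
Variables (M : lmodType (gwa s t)) (M' : lmodType (gwa s t')).

Local Notation T := (tensor (gwa_restr M) (gwa_restr M')).

Definition tens_actX_gen (v : gwa_restr M) (v' : gwa_restr M') : T :=
  tens (gwaX s t *: (v : M) : gwa_restr M)
       (gwaX s t' *: (v' : M') : gwa_restr M').

Definition tens_actY_gen (v : gwa_restr M) (v' : gwa_restr M') : T :=
  tens (gwaY s t *: (v : M) : gwa_restr M)
       (gwaY s t' *: (v' : M') : gwa_restr M').

Lemma restr_XZ u (N : lmodType (gwa s u)) r (v : gwa_restr N) :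
  (gwaX s u *: ((r *: v : gwa_restr N) : N) : gwa_restr N)
  = s r *: (gwaX s u *: (v : N) : gwa_restr N).
Proof. by rewrite !restr_scaleE !scalerA gwaXC. Qed.

Lemma restr_YZ u (N : lmodType (gwa s u)) r (v : gwa_restr N) :
  (gwaY s u *: ((r *: v : gwa_restr N) : N) : gwa_restr N)
  = aut_inv s r *: (gwaY s u *: (v : N) : gwa_restr N).
Proof. by rewrite !restr_scaleE !scalerA gwaYC. Qed.

Lemma tens_actX_balanced : balanced tens_actX_gen.
Proof.
split=> [m m' n|m n n'|r m n]; rewrite /tens_actX_gen.
- by rewrite scalerDr tensDl.
- by rewrite scalerDr tensDr.
- by rewrite !restr_XZ tensZ.
Qed.

Lemma tens_actY_balanced : balanced tens_actY_gen.
Proof.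
split=> [m m' n|m n n'|r m n]; rewrite /tens_actY_gen.
- by rewrite scalerDr tensDl.
- by rewrite scalerDr tensDr.
- by rewrite !restr_YZ tensZ.
Qed.

Definition tens_actX : T -> T := tens_lift tens_actX_balanced.
Definition tens_actY : T -> T := tens_lift tens_actY_balanced.

Fact tens_actXD : {morph tens_actX : u v / u + v}.
Proof. exact: raddfD. Qed.
Fact tens_actYD : {morph tens_actY : u v / u + v}.
Proof. exact: raddfD. Qed.

Let tens_ext (f g : T -> T) : {morph f : u v / u + v} -> {morph g : u v / u + v} ->
  (forall m n, f (tens m n) = g (tens m n)) -> f =1 g.
Proof.
move=> fD gD fg.
have z (h : T -> T) : {morph h : u v / u + v} -> h 0 = 0.
  by move=> hD; apply: (addrI (h 0)); rewrite -hD !addr0.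
elim/tens_ind => [m n||x IH|x y IHx IHy]; first exact: fg.
- by rewrite !z.
- by apply: (addIr (f x)); rewrite -fD addNr IH -gD addNr !z.
- by rewrite fD gD IHx IHy.
Qed.

Fact tens_actXZ r v : tens_actX (r *: v) = s r *: tens_actX v.
Proof.
move: v; apply: tens_ext => [u v|u v|m n] /=.
- by rewrite scalerDr tens_actXD.
- by rewrite tens_actXD scalerDr.
- by rewrite tensZl /tens_actX !tens_liftE /tens_actX_gen restr_XZ tensZl.
Qed.
Fact tens_actYZ r v : tens_actY (r *: v) = aut_inv s r *: tens_actY v.
Proof.
move: v; apply: tens_ext => [u v|u v|m n] /=.
- by rewrite scalerDr tens_actYD.
- by rewrite tens_actYD scalerDr.
- by rewrite tensZl /tens_actY !tens_liftE /tens_actY_gen restr_YZ tensZl.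
Qed.
Fact tens_actYX v : tens_actY (tens_actX v) = (t * t') *: v.
Proof.
move: v; apply: tens_ext => [u v|u v|m n] /=.
- by rewrite tens_actXD tens_actYD.
- by rewrite scalerDr.
- rewrite /tens_actX /tens_actY tens_liftE /tens_actX_gen tens_liftE /tens_actY_gen !scalerA !gwaYX -!restr_scaleE.
  by rewrite -tensZl -tensZr scalerA.
Qed.
Fact tens_actXY v : tens_actX (tens_actY v) = s (t * t') *: v.
Proof.
move: v; apply: tens_ext => [u v|u v|m n] /=.
- by rewrite tens_actYD tens_actXD.
- by rewrite scalerDr.
- rewrite /tens_actX /tens_actY tens_liftE /tens_actY_gen tens_liftE /tens_actX_gen !scalerA !gwaXY -!restr_scaleE.
  by rewrite -tensZl -tensZr scalerA rmorphM.
Qed.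

Definition tens_action : gwa_action s (t * t') T :=
  GwaAction tens_actXD tens_actYD tens_actXZ tens_actYZ tens_actYX tens_actXY.

Definition gwa_tensor : Type := gwa_module tens_action.
HB.instance Definition _ := GRing.Lmodule.on gwa_tensor.

Lemma gwa_tensorX (v : gwa_restr M) (v' : gwa_restr M') :
  gwaX s (t * t') *: (tens v v' : gwa_tensor) = tens_actX_gen v v'.
Proof. by rewrite gwa_moduleX /= /tens_actX tens_liftE. Qed.

Lemma gwa_tensorY (v : gwa_restr M) (v' : gwa_restr M') :
  gwaY s (t * t') *: (tens v v' : gwa_tensor) = tens_actY_gen v v'.
Proof. by rewrite gwa_moduleY /= /tens_actY tens_liftE. Qed.

End TensorGwa.

Inductive letter := L1 | Lx | Ly | L0.

Definition letter_eq_dec (a b : letter) : {a = b} + {a <> b}.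
Proof. by decide equality. Defined.

HB.instance Definition _ := hasDecEq.Build letter
  (fun a b => sumboolP (letter_eq_dec a b)).

Definition letter_mul (a b : letter) : letter :=
  match a, b with
  | L1, c | c, L1 => c
  | Lx, Lx => Lx
  | Ly, Ly => Ly
  | _, _ => L0
  end.

(* The k-th letter, for k >= 1, of the word w_1 ... w_n, k being read mod n. *)
Definition wat (n : nat) (w : n.-tuple letter) (k : nat) : letter :=
  nth L0 w (k.-1 %% n).

Section Words.
Variables (R : comNzRingType) (s : ringAut R) (p : nat) (m0 : maxSpec R).

Definition omega : set (maxSpec R) :=
  [set iter k (aut_max s) m0 | k in `I_p]%classic.

Definition Bset (t : R) : set (maxSpec R) :=
  [set m | omega m /\ t \in m]%classic.

Definition inD (t : R) (n : nat) (w : n.-tuple letter) : Prop :=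
  forall k, (0 < k <= n)%N ->
    (wat w k = L1 <-> ~ Bset t (iter k (aut_max s) m0)).

(* Only words indexed from 1, of length r p, are needed from D^t_omega. *)
Record Dword (t : R) (r : nat) := DWord {
  dword :> (r * p).-tuple letter;
  dwordP : inD t dword }.

Hypothesis sp : forall x, iter p s x = x.

Lemma aut_inv_p x : iter p (aut_inv s) x = x.
Proof.
have K n y : iter n (aut_inv s) (iter n s y) = y.
  by elim: n y => // n IH y; rewrite iterSr /= autK IH.
by rewrite -{1}[x]sp K.
Qed.

Lemma aut_max_p : iter p (aut_max s) m0 = m0.
Proof. by apply: maxSpec_inj => x; rewrite mem_aut_max aut_inv_p. Qed.

Lemma aut_max_pM q k :
  iter (k + q * p) (aut_max s) m0 = iter k (aut_max s) m0.
Proof.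
by rewrite iterD; congr iter; elim: q => // q IH; rewrite mulSn iterD IH aut_max_p.
Qed.

Lemma aut_max_mod q k : (p %| q)%N ->
  iter (k %% q).+1 (aut_max s) m0 = iter k.+1 (aut_max s) m0.
Proof.
case/dvdnP => c ->.
have -> : k.+1 = ((k %% (c * p)).+1 + (k %/ (c * p) * c) * p)%N.
  by rewrite -mulnA addSn addnC -divn_eq.
by rewrite aut_max_pM.
Qed.

Lemma omega_iter k : (0 < p)%N -> omega (iter k (aut_max s) m0).
Proof.
move=> p0; exists (k %% p)%N; first exact: ltn_pmod.
by rewrite [in RHS](divn_eq k p) addnC aut_max_pM.
Qed.

Lemma BsetP t k : (0 < p)%N ->
  Bset t (iter k (aut_max s) m0) <-> t \in iter k (aut_max s) m0.
Proof. by move=> p0; split=> [[]//|tk]; split=> //; exact: omega_iter. Qed.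

Lemma dword_p_gt0 r k : (0 < k <= r * p)%N -> (0 < p)%N.
Proof. by case: (posnP p) => // ->; rewrite muln0; case: k. Qed.

Lemma wat_mod n (w : n.-tuple letter) k : wat w (k %% n).+1 = wat w k.+1.
Proof. by rewrite /wat /= modn_mod. Qed.

Lemma DwordP t r (w : Dword t r) k : (0 < r * p)%N ->
  (wat w k.+1 == L1) = (t \notin iter k.+1 (aut_max s) m0).
Proof.
move=> rp0; rewrite -wat_mod -(@aut_max_mod (r * p)) ?dvdn_mull //.
have kn : (0 < (k %% (r * p)).+1 <= r * p)%N by rewrite /= ltn_pmod.
have p0 : (0 < p)%N by case: (posnP p) rp0 => // ->; rewrite muln0.
apply/eqP/negP => [/(dwordP w kn)|] H.
  by move=> tm; apply: H; apply/BsetP.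
by apply/(dwordP w kn) => /(BsetP _ _ p0).
Qed.

(* w (x) w', of length r r' p / d, where d = gcd (r, r') and lcm (r, r') =    *)
(* r r' / d.                                                                  *)
Definition word_mul (r r' : nat) (w : (r * p).-tuple letter)
    (w' : (r' * p).-tuple letter) : (lcmn r r' * p).-tuple letter :=
  [tuple letter_mul (wat w i.+1) (wat w' i.+1) | i < lcmn r r' * p].

(* The word w[j], with letters w_{k + jp}. *)
Definition word_shift (r : nat) (w : (r * p).-tuple letter) (j : nat) :
    (r * p).-tuple letter :=
  [tuple wat w (i.+1 + j * p) | i < r * p].

Lemma wat_tuple n (f : nat -> letter) k : (0 < k <= n)%N ->
  wat [tuple f i | i < n] k = f k.-1.
Proof.
case: k => // k kn; rewrite /wat /= modn_small //.
rewrite (nth_map (Ordinal kn)) ?size_enum_ord //.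
by rewrite nth_enum_ord.
Qed.

Lemma wat_mul r r' (w : (r * p).-tuple letter) (w' : (r' * p).-tuple letter) k :
  (0 < k <= lcmn r r' * p)%N ->
  wat (word_mul w w') k = letter_mul (wat w k) (wat w' k).
Proof.
case: k => // k.
exact: (@wat_tuple _ (fun i => letter_mul (wat w i.+1) (wat w' i.+1)) k.+1).
Qed.

Lemma wat_shift r (w : (r * p).-tuple letter) j k : (0 < k <= r * p)%N ->
  wat (word_shift w j) k = wat w (k + j * p).
Proof.
case: k => // k; exact: (@wat_tuple _ (fun i => wat w (i.+1 + j * p)) k.+1).
Qed.

Lemma word_mulP t t' r r' (w : Dword t r) (w' : Dword t' r') :
  inD (t * t') (word_mul w w').
Proof.
move=> [//|k] kn; rewrite wat_mul //.
have := dword_p_gt0 kn => p0.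
have : (0 < lcmn r r' * p)%N by case/andP: kn => _; exact: leq_ltn_trans.
rewrite muln_gt0 lcmn_gt0 => /andP[/andP[r0 r'0] _].
have e1 := DwordP w k; have e2 := DwordP w' k.
rewrite muln_gt0 r0 p0 in e1; rewrite muln_gt0 r'0 p0 in e2.
have {}e1 := e1 isT; have {}e2 := e2 isT.
split.
- move=> e /(BsetP _ _ p0); rewrite maxSpecM => /orP[tm|tm].
    by move: e1 e; rewrite tm; case: (wat w _) (wat w' _) => [] [].
  by move: e2 e; rewrite tm; case: (wat w _) (wat w' _) => [] [].
- move=> nB; have : t * t' \notin iter k.+1 (aut_max s) m0.
    by apply/negP => /(BsetP _ _ p0).
  rewrite maxSpecM negb_or -e1 -e2 => /andP[/eqP e1' /eqP e2'].
  by rewrite e1' e2'.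
Qed.

Lemma word_shiftP t r (w : Dword t r) j : inD t (word_shift w j).
Proof.
move=> [//|k] kn; rewrite wat_shift //.
have p0 := dword_p_gt0 kn.
have rp : (0 < r * p)%N by case/andP: kn => _; exact: leq_ltn_trans.
have e := DwordP w (k + j * p) rp; rewrite -addSn aut_max_pM in e.
split=> [/eqP|nB].
  by rewrite e => /negP tm /(BsetP _ _ p0).
by apply/eqP; rewrite e; apply/negP => /(BsetP _ _ p0).
Qed.

Definition dword_mul t t' r r' (w : Dword t r) (w' : Dword t' r') :
  Dword (t * t') (lcmn r r') := DWord (word_mulP w w').

Definition dword_shift t r (w : Dword t r) (j : nat) : Dword t r :=
  DWord (word_shiftP w j).

(* u^{w,w'} as an element of R, to be read modulo sigma(m_0). *)
Definition upow (r r' : nat) (w : (r * p).-tuple letter)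
    (w' : (r' * p).-tuple letter) (u : R) : R :=
  \prod_(1 <= j < (lcmn r r' * p).+1 | (wat w j == L1) && (wat w' j == Lx))
    autz s (p%:Z + 1 - j%:Z) u.

(* Its image in k = R / m_0 under the isomorphism R / sigma(m_0) -> R / m_0   *)
(* inverse to the one induced by sigma.                                       *)
Definition kpow (r r' : nat) (w : (r * p).-tuple letter)
    (w' : (r' * p).-tuple letter) (u : R) : resfield m0 :=
  rescl m0 (aut_inv s (upow w w' u)).

Lemma autz_p_sub (j : nat) (u : R) :
  autz s (p%:Z - j%:Z) u = iter j (aut_inv s) u.
Proof.
elim: j => [|j IH]; first by rewrite subr0 /= sp.
by rewrite -addn1 PoszD opprD addrA -autz_pred IH addn1.
Qed.

Lemma kpow_neq0 t r r' (w : Dword t r) (w' : (r' * p).-tuple letter) :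
  kpow w w' t != 0.
Proof.
rewrite /kpow rescl_eq0 /upow rmorph_prod /= big_nat_cond.
elim/big_ind: _ => [|x y|[//|j]].
- by rewrite (idealr1 (max_pred m0)).
- by rewrite maxSpecM negb_or => -> ->.
- case/andP => jn /andP[jw _]; rewrite autz_pred addrAC addrK autz_p_sub.
  have p0 := @dword_p_gt0 (lcmn r r') j.+1 jn.
  have : (0 < lcmn r r' * p)%N by case/andP: jn => _; rewrite ltnS; exact: leq_ltn_trans.
  rewrite muln_gt0 lcmn_gt0 => /andP[/andP[r0 r'0] _].
  by rewrite -mem_aut_max -(DwordP w) // muln_gt0 r0.
Qed.

(* The scalar t^{w,w'} t'^{w',w} of k^x. *)
Definition kscal t t' r r' (w : Dword t r) (w' : Dword t' r') : kunit m0 :=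
  exist (fun x : resfield m0 => x != 0) (kpow w w' t * kpow w' w t')
    (mulf_neq0 (kpow_neq0 w w') (kpow_neq0 w' w)).

Section VModule.
Variables (t : R) (r : nat) (w : Dword t r) (xi : kunit m0).

Local Notation n := (r * p)%N.

(* The ordinal i : 'I_n stands for the index k = i.+1. *)
Definition Vsum : Type :=
  dsum (fun i : 'I_n => resfield (iter i.+1 (aut_max s) m0)).
HB.instance Definition _ := GRing.Lmodule.on Vsum.

Definition Ve (i : 'I_n) : Vsum := [ffun j => (j == i)%:R].

(* For c in R / sigma^k(m_0), the element c e_k is written resrep c *: e_k;   *)
(* sigma(xi) is the class of s (resrep xi). ordS is the cyclic successor.     *)
Definition VXe (i : 'I_n) : Vsum :=
  match wat w i.+1 with
  | L1 => if i.+1 == n then (s t * s (resrep (val xi))) *: Ve (ordS i)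
          else s t *: Ve (ordS i)
  | Lx => if i.+1 == n then s (resrep (val xi)) *: Ve (ordS i)
          else Ve (ordS i)
  | _ => 0
  end.

Definition VYe (i : 'I_n) : Vsum :=
  match wat w (ord_pred i).+1 with
  | L1 | Ly => if i == 0%N :> nat
               then resrep (val xi)^-1 *: Ve (ord_pred i)
               else Ve (ord_pred i)
  | _ => 0
  end.

Definition VX (v : Vsum) : Vsum := \sum_i s (resrep (v i)) *: VXe i.
Definition VY (v : Vsum) : Vsum := \sum_i aut_inv s (resrep (v i)) *: VYe i.

Local Notation mi i := (iter (nat_of_ord i).+1 (aut_max s) m0).

Lemma n_gt0 (i : 'I_n) : (0 < n)%N.
Proof. exact: leq_ltn_trans (ltn_ord i). Qed.

Lemma mi_ordS (i : 'I_n) : mi (ordS i) = aut_max s (mi i).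
Proof. exact: (@aut_max_mod n i.+1 (dvdn_mull r (dvdnn p))). Qed.

Lemma mem_ordS (i : 'I_n) a : (a \in mi (ordS i)) = (aut_inv s a \in mi i).
Proof. by rewrite mi_ordS. Qed.

Lemma mem_ord_pred (i : 'I_n) a : (a \in mi (ord_pred i)) = (s a \in mi i).
Proof. by rewrite -{2}[i]ord_predK mem_ordS autK. Qed.

Lemma Ve_ann (i : 'I_n) a : a \in mi i -> a *: Ve i = 0.
Proof.
move=> ai; apply/ffunP => j; rewrite dsumZE dsum0E ffunE.
have [->|_] := eqVneq j i; last by rewrite scaler0.
by rewrite resfield_scaleE mulr1; apply/eqP; rewrite rescl_eq0.
Qed.

Lemma VXe_ann (i : 'I_n) a : a \in mi i -> s a *: VXe i = 0.
Proof.
move=> ai; have H : s a \in mi (ordS i) by rewrite mem_ordS autK.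
rewrite /VXe; case: wat; rewrite ?scaler0 //; case: ifP => _;
by rewrite ?scalerA 1?mulrC Ve_ann // idealMr.
Qed.

Lemma VYe_ann (i : 'I_n) a : a \in mi i -> aut_inv s a *: VYe i = 0.
Proof.
move=> ai; have H : aut_inv s a \in mi (ord_pred i).
  by rewrite mem_ord_pred aut_invK.
rewrite /VYe; case: wat; rewrite ?scaler0 //; case: ifP => _;
by rewrite ?scalerA 1?mulrC Ve_ann // idealMr.
Qed.

Lemma rescl_sub_mem (m : maxSpec R) a b : rescl m a = rescl m b -> a - b \in m.
Proof. by move=> ab; rewrite -rescl_eq0 rmorphB /= ab subrr. Qed.

Lemma VXe_cl (i : 'I_n) a b : rescl (mi i) a = rescl (mi i) b ->
  s a *: VXe i = s b *: VXe i.
Proof.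
move=> ab; apply/eqP; rewrite -subr_eq0 -scalerBl -rmorphB.
by rewrite VXe_ann // rescl_sub_mem.
Qed.

Lemma VYe_cl (i : 'I_n) a b : rescl (mi i) a = rescl (mi i) b ->
  aut_inv s a *: VYe i = aut_inv s b *: VYe i.
Proof.
move=> ab; apply/eqP; rewrite -subr_eq0 -scalerBl -rmorphB.
by rewrite VYe_ann // rescl_sub_mem.
Qed.

Lemma V_decomp (v : Vsum) : v = \sum_i resrep (v i) *: Ve i.
Proof.
apply/ffunP => j; rewrite dsum_sumE (bigD1 j) //= big1 ?addr0.
  by rewrite dsumZE ffunE eqxx resfield_scaleE mulr1 resrepK.
by move=> i ij; rewrite dsumZE ffunE eq_sym (negbTE ij) scaler0.
Qed.

Fact VXD : {morph VX : u v / u + v}.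
Proof.
move=> u v; rewrite /VX -big_split; apply: eq_bigr => i _ /=.
rewrite -scalerDl -rmorphD; apply: VXe_cl.
by rewrite rmorphD /= !resrepK dsumDE.
Qed.
Fact VYD : {morph VY : u v / u + v}.
Proof.
move=> u v; rewrite /VY -big_split; apply: eq_bigr => i _ /=.
rewrite -scalerDl -rmorphD; apply: VYe_cl.
by rewrite rmorphD /= !resrepK dsumDE.
Qed.
Fact VXZ a v : VX (a *: v) = s a *: VX v.
Proof.
rewrite /VX scaler_sumr; apply: eq_bigr => i _.
rewrite scalerA -rmorphM; apply: VXe_cl.
by rewrite rmorphM /= !resrepK dsumZE.
Qed.
Fact VYZ a v : VY (a *: v) = aut_inv s a *: VY v.
Proof.
rewrite /VY scaler_sumr; apply: eq_bigr => i _.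
rewrite scalerA -rmorphM; apply: VYe_cl.
by rewrite rmorphM /= !resrepK dsumZE.
Qed.

Lemma VX_e i : VX (Ve i) = VXe i.
Proof.
rewrite /VX (bigD1 i) //= big1 ?addr0.
  rewrite -[RHS]scale1r -(rmorph1 s); apply: VXe_cl.
  by rewrite resrepK rmorph1 ffunE eqxx.
move=> j ji; rewrite -[RHS](scale0r (VXe j)) -(rmorph0 s); apply: VXe_cl.
by rewrite resrepK rmorph0 ffunE (negbTE ji).
Qed.

Lemma VY_e i : VY (Ve i) = VYe i.
Proof.
rewrite /VY (bigD1 i) //= big1 ?addr0.
  rewrite -[RHS]scale1r -(rmorph1 (aut_inv s)); apply: VYe_cl.
  by rewrite resrepK rmorph1 ffunE eqxx.
move=> j ji; rewrite -[RHS](scale0r (VYe j)) -(rmorph0 (aut_inv s)).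
by apply: VYe_cl; rewrite resrepK rmorph0 ffunE (negbTE ji).
Qed.

Lemma VX0 : VX 0 = 0.
Proof. by rewrite -[0 in LHS](scale0r (0 : Vsum)) VXZ rmorph0 scale0r. Qed.
Lemma VY0 : VY 0 = 0.
Proof. by rewrite -[0 in LHS](scale0r (0 : Vsum)) VYZ rmorph0 scale0r. Qed.

Lemma ordS_eq0 (i : 'I_n) : (ordS i == 0%N :> nat) = (i.+1 == n).
Proof.
have := ltn_ord i; rewrite leq_eqVlt /= => /orP[/eqP e|lt].
  by rewrite e modnn !eqxx.
by rewrite modn_small // (ltn_eqF lt).
Qed.

Lemma mi_last (i : 'I_n) : i.+1 = n -> mi i = m0.
Proof. by move=> ->; rewrite -[(r * p)%N]add0n aut_max_pM. Qed.

Lemma xiV_scale (i : 'I_n) : i.+1 = n ->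
  (resrep (val xi) * resrep (val xi)^-1) *: Ve i = Ve i.
Proof.
move=> e; rewrite -[RHS]scale1r; apply/eqP; rewrite -subr_eq0 -scalerBl.
rewrite Ve_ann // (mi_last e) -rescl_eq0 rmorphB rmorphM rmorph1 /= !resrepK.
by rewrite mulfV ?subrr //; exact: (valP xi).
Qed.

Lemma xiV_scaleS (i : 'I_n) : i.+1 = n ->
  s (resrep (val xi) * resrep (val xi)^-1) *: Ve (ordS i) = Ve (ordS i).
Proof.
move=> e; rewrite -[RHS]scale1r; apply/eqP; rewrite -subr_eq0 -scalerBl.
rewrite -(rmorph1 s) -rmorphB Ve_ann // mem_ordS autK (mi_last e) -rescl_eq0.
rewrite rmorphB rmorphM rmorph1 /= !resrepK.
by rewrite mulfV ?subrr //; exact: (valP xi).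
Qed.

Lemma wat_neq1 (i : 'I_n) : wat w i.+1 != L1 -> t *: Ve i = 0.
Proof.
by move=> wi; apply: Ve_ann; rewrite (DwordP w i (n_gt0 i)) negbK in wi.
Qed.

Lemma wat_neq1S (i : 'I_n) : wat w i.+1 != L1 -> s t *: Ve (ordS i) = 0.
Proof.
move=> wi; apply: Ve_ann; rewrite mem_ordS autK.
by rewrite (DwordP w i (n_gt0 i)) negbK in wi.
Qed.

Lemma VYXe i : VY (VXe i) = t *: Ve i.
Proof.
have := @wat_neq1 i; have := VY_e (ordS i).
rewrite /VXe /VYe ordS_eq0 ordSK; case: wat => E H.
- case: eqP E => [e|_] E; rewrite !VYZ E ?rmorphM /= ?autK //.
  by rewrite scalerA -mulrA -scalerA xiV_scale.
- by rewrite H //; case: eqP E => [e|_] E; rewrite ?VYZ E ?scaler0.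
- by rewrite H // VY0.
- by rewrite H // VY0.
Qed.

Lemma VXYe i : VX (VYe i) = s t *: Ve i.
Proof.
rewrite -[i]ord_predK; set j := ord_pred i; clearbody j.
have := @wat_neq1S j; have := VX_e j.
rewrite /VXe /VYe ordS_eq0 ordSK; case: wat => E H.
- case: eqP E => [e|_] E; rewrite ?VXZ E //.
  by rewrite scalerA mulrCA -scalerA -rmorphM mulrC xiV_scaleS.
- by rewrite H // VX0.
- by rewrite H //; case: eqP E => [e|_] E; rewrite ?VXZ E ?scaler0.
- by rewrite H // VX0.
Qed.

Lemma VX_sum (J : Type) (l : seq J) (F : J -> Vsum) :
  VX (\sum_(j <- l) F j) = \sum_(j <- l) VX (F j).
Proof. by apply: (big_morph VX VXD VX0). Qed.
Lemma VY_sum (J : Type) (l : seq J) (F : J -> Vsum) :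
  VY (\sum_(j <- l) F j) = \sum_(j <- l) VY (F j).
Proof. by apply: (big_morph VY VYD VY0). Qed.

Fact VYX v : VY (VX v) = t *: v.
Proof.
rewrite {1}/VX VY_sum {2}[v]V_decomp scaler_sumr; apply: eq_bigr => i _.
by rewrite VYZ autK VYXe !scalerA mulrC.
Qed.
Fact VXY v : VX (VY v) = s t *: v.
Proof.
rewrite {1}/VY VX_sum {2}[v]V_decomp scaler_sumr; apply: eq_bigr => i _.
by rewrite VXZ aut_invK VXYe !scalerA mulrC.
Qed.

Definition V_action : gwa_action s t Vsum :=
  GwaAction VXD VYD VXZ VYZ VYX VXY.

Definition Vmod : Type := gwa_module V_action.
HB.instance Definition _ := GRing.Lmodule.on Vmod.

End VModule.
End Words.

(* Main.v *)
(* A tensor e_a (x) e'_b of basis vectors vanishes unless a = b mod p, since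
   otherwise it is killed by two distinct maximal ideals. On the remaining
   index pairs, X shifts both indices by one, and the d orbits of this shift
   are (k, k + jp) for j < d, with k running modulo lcm(r, r') p. Along the
   j-th orbit X and Y act by the letters of w (x) w'[j], up to factors sigma(t)
   and sigma(t') where the letter x arises as 1.x or x.1; rescaling the basis
   along the orbit removes these factors, and their product reappears once, at
   the end of the cycle. *)
Require Import Defs.
From HB Require Import structures.
From mathcomp Require Import all_boot all_order all_algebra.
From mathcomp Require Import boolp classical_sets cardinality.

Import GRing.Theory.
Local Open Scope ring_scope.

Set Implicit Arguments.
Unset Strict Implicit.
Unset Printing Implicit Defensive.

(** * Linearity over A(t) *)

Section GwaLinear.
Variables (R : comNzRingType) (s : ringAut R) (t : R).
Variables (M N : lmodType (gwa s t)) (f : M -> N).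
Hypothesis fD : {morph f : u v / u + v}.
Hypothesis fC : forall r v, f (gwaC s t r *: v) = gwaC s t r *: f v.
Hypothesis fX : forall v, f (gwaX s t *: v) = gwaX s t *: f v.
Hypothesis fY : forall v, f (gwaY s t *: v) = gwaY s t *: f v.

(** Elements of A(t) are classes of formal expressions in constants, X and Y, so induction on
    expressions reduces the claim to the generators. *)
Lemma gwa_linear : linear f.
Proof.
move=> a u v; rewrite fD; congr (_ + _); move: u; elim/gwa_ind: a.
have f0 : f 0 = 0 by apply: (addrI (f 0)); rewrite -fD !addr0.
elim=> [r|||a IH|a IHa b IHb|a IHa b IHb] u.
- exact: fC.
- exact: fX.
- exact: fY.
- rewrite gwa_clN !scaleNr -IH; apply: (addIr (f (gwa_cl s t a *: u))).
  by rewrite -fD !addNr.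
- by rewrite gwa_clD !scalerDl fD IHa IHb.
- by rewrite gwa_clM -!scalerA IHa IHb.
Qed.

End GwaLinear.

(** * Residue fields at equal maximal ideals *)

Section ResfieldCast.
Variables (R : comNzRingType) (m m' : maxSpec R).
Hypothesis mm' : m = m'.

(** Residue fields at propositionally equal ideals are distinct types; they are identified through
    representatives, and [mm'] makes this passage additive. *)
Lemma rescl_resrepD (x y : resfield m) :
  rescl m' (resrep (x + y)) = rescl m' (resrep x) + rescl m' (resrep y).
Proof. by case: _ / mm'; rewrite !resrepK. Qed.

Lemma rescl_resrepZ a (x : resfield m) :
  rescl m' (resrep (a *: x)) = rescl m' a * rescl m' (resrep x).
Proof. by case: _ / mm'; rewrite !resrepK. Qed.

Lemma rescl_resrep_nat n : rescl m' (resrep (n%:R : resfield m)) = n%:R.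
Proof. by case: _ / mm'; rewrite !resrepK. Qed.

End ResfieldCast.

(** * Maps out of the modules V *)

Section VmodLift.
Variables (R : comNzRingType) (s : ringAut R) (p : nat) (m0 : maxSpec R).
Hypothesis sp : forall x, iter p s x = x.
Variables (t : R) (r : nat) (w : Dword s p m0 t r) (xi : kunit m0).

Local Notation mx k := (iter k (aut_max s) m0).
Local Notation V := (Vmod sp w xi).

Lemma Vmod_C a (v : V) : gwaC s t a *: v = (a *: (v : Vsum s p m0 r)).
Proof. exact: gwa_moduleC. Qed.
Lemma Vmod_X (v : V) : gwaX s t *: v = VX w xi v.
Proof. exact: gwa_moduleX. Qed.
Lemma Vmod_Y (v : V) : gwaY s t *: v = VY w xi v.
Proof. exact: gwa_moduleY. Qed.

Variables (N : lmodType (gwa s t)) (b : 'I_(r * p) -> N).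

(** The choice of representatives is immaterial once [b_ann] holds. *)
Definition Vlift (v : Vsum s p m0 r) : N :=
  \sum_i gwaC s t (resrep (v i)) *: b i.

Hypothesis b_ann :
  forall (i : 'I_(r * p)) a, a \in mx i.+1 -> gwaC s t a *: b i = 0.

Lemma Vlift_cl (i : 'I_(r * p)) a a' : rescl (mx i.+1) a = rescl (mx i.+1) a' ->
  gwaC s t a *: b i = gwaC s t a' *: b i.
Proof.
move=> aa'; apply/eqP; rewrite -subr_eq0 -scalerBl -rmorphB /=.
by rewrite b_ann // rescl_sub_mem.
Qed.

Lemma VliftD : {morph Vlift : u v / u + v}.
Proof.
move=> u v; rewrite -big_split; apply: eq_bigr => i _ /=.
rewrite -scalerDl -rmorphD; apply: Vlift_cl.
by rewrite rmorphD /= !resrepK dsumDE.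
Qed.

Lemma VliftZ a v : Vlift (a *: v) = gwaC s t a *: Vlift v.
Proof.
rewrite scaler_sumr; apply: eq_bigr => i _.
rewrite scalerA -rmorphM; apply: Vlift_cl.
by rewrite rmorphM /= !resrepK dsumZE.
Qed.

Lemma Vlift0 : Vlift 0 = 0.
Proof. by rewrite -[in LHS](scale0r 0) VliftZ rmorph0 scale0r. Qed.

Lemma Vlift_e i : Vlift (Ve s m0 i) = b i.
Proof.
rewrite /Vlift (bigD1 i) //= big1 ?addr0 => [|j ji].
  rewrite -[RHS]scale1r -(rmorph1 (gwaC s t)); apply: Vlift_cl.
  by rewrite resrepK ffunE eqxx [RHS]rmorph1.
rewrite -[RHS](scale0r (b j)) -(rmorph0 (gwaC s t)); apply: Vlift_cl.
by rewrite resrepK ffunE (negbTE ji) [RHS]rmorph0.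
Qed.

Lemma Vlift_sum J (l : seq J) (F : J -> Vsum s p m0 r) :
  Vlift (\sum_(j <- l) F j) = \sum_(j <- l) Vlift (F j).
Proof. exact: (big_morph Vlift VliftD Vlift0). Qed.

Hypothesis b_X : forall i, gwaX s t *: b i = Vlift (VXe w xi i).
Hypothesis b_Y : forall i, gwaY s t *: b i = Vlift (VYe w xi i).

(** X and Y act semilinearly, so compatibility on basis vectors is enough. *)
Lemma Vlift_linear : linear (Vlift : V -> N).
Proof.
apply: gwa_linear => [u v|a v|v|v].
- exact: VliftD.
- by rewrite Vmod_C VliftZ.
- rewrite Vmod_X [in LHS]/VX Vlift_sum scaler_sumr; apply: eq_bigr => i _.
  by rewrite VliftZ -b_X !scalerA gwaXC.
- rewrite Vmod_Y [in LHS]/VY Vlift_sum scaler_sumr; apply: eq_bigr => i _.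
  by rewrite VliftZ -b_Y !scalerA gwaYC.
Qed.

End VmodLift.

(** * The cyclic basis and the coefficients of X and Y along it *)

Definition letterX (R : comNzRingType) (s : ringAut R) (u : R)
    (a : letter) : R :=
  match a with L1 => s u | Lx => 1 | _ => 0 end.

Definition letterY (R : comNzRingType) (a : letter) : R :=
  match a with L1 | Ly => 1 | _ => 0 end.

Definition cyc_ord (n : nat) (n_gt0 : (0 < n)%N) (k : nat) : 'I_n :=
  Ordinal (ltn_pmod k n_gt0).

Section CyclicBasis.
Variables (R : comNzRingType) (s : ringAut R) (p : nat) (m0 : maxSpec R).
Hypothesis sp : forall x, iter p s x = x.
Variables (t : R) (r : nat) (w : Dword s p m0 t r).

Local Notation mx k := (iter k (aut_max s) m0).

Lemma VXeE xi (i : 'I_(r * p)) : VXe w xi i =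
  (letterX s t (wat w i.+1) *
    (if i.+1 == (r * p)%N then s (resrep (val xi)) else 1)) *: Ve s m0 (ordS i).
Proof.
rewrite /VXe; case: wat; case: eqP => _ /=;
  by rewrite ?mul0r ?mulr1 ?mul1r ?scale0r ?scale1r.
Qed.

Lemma VYeE xi (i : 'I_(r * p)) : VYe w xi i =
  (letterY R (wat w (ord_pred i).+1) *
    (if i == 0%N :> nat then resrep (val xi)^-1 else 1)) *:
  Ve s m0 (ord_pred i).
Proof.
rewrite /VYe; case: wat; case: eqP => _ /=;
  by rewrite ?mul0r ?mulr1 ?mul1r ?scale0r ?scale1r.
Qed.

(** The chosen representative of 1 need not be 1, but its image under sigma is 1 modulo sigma(m_0),
    which annihilates e_1. *)
Lemma VXe1 (i : 'I_(r * p)) : VXe w (kunit1 m0) i =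
  letterX s t (wat w i.+1) *: Ve s m0 (ordS i).
Proof.
rewrite VXeE; case: eqP => [e|_]; last by rewrite mulr1.
rewrite -scalerA; congr (_ *: _); rewrite -[RHS]scale1r -(rmorph1 s).
apply/eqP; rewrite -subr_eq0 -scalerBl -rmorphB Ve_ann // mem_ordS // autK.
by rewrite (mi_last m0 sp e) -rescl_eq0 rmorphB rmorph1 /= resrepK subrr.
Qed.

Lemma VYe1 (i : 'I_(r * p)) : VYe w (kunit1 m0) i =
  letterY R (wat w (ord_pred i).+1) *: Ve s m0 (ord_pred i).
Proof.
rewrite VYeE -{2}[i]ord_predK ordS_eq0.
case: eqP => [e|_]; last by rewrite mulr1.
rewrite -scalerA; congr (_ *: _); rewrite -[RHS]scale1r.
apply/eqP; rewrite -subr_eq0 -scalerBl Ve_ann //.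
by rewrite (mi_last m0 sp e) -rescl_eq0 rmorphB rmorph1 /= resrepK invr1 subrr.
Qed.

Hypothesis rp_gt0 : (0 < r * p)%N.

(** This is e_{k+1}, indices modulo r p; allowing every natural number removes the end-of-cycle case
    from the formulas for X and Y. *)
Definition cycE (k : nat) : Vmod sp w (kunit1 m0) := Ve s m0 (cyc_ord rp_gt0 k).

Lemma cycE_mod k k' : k = k' %[mod r * p] -> cycE k = cycE k'.
Proof. by move=> kk'; congr (Ve _ _ _); apply: val_inj. Qed.

Lemma ordS_cyc k : ordS (cyc_ord rp_gt0 k) = cyc_ord rp_gt0 k.+1.
Proof. by apply: val_inj; rewrite /= -addn1 modnDml addn1. Qed.

Lemma mx_cyc k : mx (cyc_ord rp_gt0 k).+1 = mx k.+1.
Proof. by apply: aut_max_mod => //; exact: dvdn_mull. Qed.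

Lemma cycE_ann k a : a \in mx k.+1 -> gwaC s t a *: cycE k = 0.
Proof. by rewrite -mx_cyc Vmod_C => ak; rewrite Ve_ann. Qed.

Lemma cycE_X k :
  gwaX s t *: cycE k = gwaC s t (letterX s t (wat w k.+1)) *: cycE k.+1.
Proof.
by rewrite Vmod_X Vmod_C (VX_e sp) VXe1 /cycE -ordS_cyc wat_mod.
Qed.

Lemma cycE_Y k :
  gwaY s t *: cycE k.+1 = gwaC s t (letterY R (wat w k.+1)) *: cycE k.
Proof.
by rewrite Vmod_Y Vmod_C (VY_e sp) VYe1 /cycE -ordS_cyc ordSK wat_mod.
Qed.

End CyclicBasis.

(** * Factors accumulated along a cycle *)

Section Twist.
Variables (R : comNzRingType) (s : ringAut R) (p : nat) (m0 : maxSpec R).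
Hypothesis sp : forall x, iter p s x = x.
Variables (P : pred nat) (u : R).

Fixpoint twist (k : nat) : R :=
  if k is k'.+1 then s (twist k') * (if P k then s u else 1) else 1.

Lemma twistE k : twist k = \prod_(1 <= j < k.+1 | P j) iter (k.+1 - j) s u.
Proof.
elim: k => [|k IH]; first by rewrite big_geq.
rewrite big_mkcond big_nat_recr //= -big_mkcond IH rmorph_prod subSnn.
congr (_ * _); apply: congr_big_nat => // j /and3P[_ _ jk].
by rewrite (subSn (ltnW jk)).
Qed.

(** The two exponents differ by a multiple of p; the one with q p stays a natural number for all j
    up to q p. *)
Lemma autz_iter q j v : (j <= q * p)%N ->
  autz s (p%:Z + 1 - j%:Z) v = iter ((q * p).+1 - j) s v.
Proof.
move=> jq; apply: (can_inj (@aut_invK R s)).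
rewrite autz_pred addrAC addrK autz_p_sub // subSn //= autK.
have {1}-> : v = iter j s (iter (q * p - j) s v).
  rewrite -iterD subnKC //; elim: q {jq} => //= q IH.
  by rewrite mulSn iterD sp.
by elim: j {jq} (iter _ s v) => //= j IH x; rewrite -iterS iterSr /= autK IH.
Qed.

(** Maximal ideals are prime and sigma carries each ideal of the orbit to the next, so only the
    newest factor needs checking. *)
Lemma twist_notin k : (forall j, P j.+1 -> u \notin iter j.+1 (aut_max s) m0) ->
  twist k \notin iter k.+1 (aut_max s) m0.
Proof.
move=> Pu; elim: k => [|k IH]; first by rewrite (idealr1 (max_pred _)).
rewrite maxSpecM negb_or /= inE autK IH /=.
case: ifPn => [/Pu|_]; first by rewrite !inE autK.
by rewrite !inE !rmorph1 (idealr1 (max_pred _)).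
Qed.

End Twist.

(** * The summand spanned by one orbit of index pairs *)

Section Component.
Variables (R : comNzRingType) (s : ringAut R) (p : nat) (m0 : maxSpec R).
Hypothesis sp : forall x, iter p s x = x.
Variables (t t' : R) (r r' : nat).
Variables (w : Dword s p m0 t r) (w' : Dword s p m0 t' r').
Hypotheses (rp_gt0 : (0 < r * p)%N) (r'p_gt0 : (0 < r' * p)%N).
Variable j : nat.

Local Notation mx k := (iter k (aut_max s) m0).
Local Notation V := (Vmod sp w (kunit1 m0)).
Local Notation V' := (Vmod sp w' (kunit1 m0)).
Local Notation T := (gwa_tensor V V').
Local Notation n := (lcmn r r' * p)%N.
Local Notation wj := (dword_shift sp w' j).
Local Notation xi := (kscal sp w wj).

Lemma gwa_tensorC a (x : T) :
  gwaC s (t * t') a *: x = (a *: (x : tensor (gwa_restr V) (gwa_restr V')) : T).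
Proof. exact: gwa_moduleC. Qed.

Lemma tens_gwaC a a' (v : V) (v' : V') :
  (tens (gwaC s t a *: v : gwa_restr V) (gwaC s t' a' *: v' : gwa_restr V') : T)
  = gwaC s (t * t') (a * a') *:
    (tens (v : gwa_restr V) (v' : gwa_restr V') : T).
Proof. by rewrite gwa_tensorC -scalerA tensZr tensZl. Qed.

(** As k counts from 0, this is the tensor of e_{k+1} and e'_{k+1+jp}. *)
Definition diagE (k : nat) : T :=
  tens (cycE sp w rp_gt0 k : gwa_restr V)
       (cycE sp w' r'p_gt0 (k + j * p) : gwa_restr V').

Lemma diagE_ann k a : a \in mx k.+1 -> gwaC s (t * t') a *: diagE k = 0.
Proof.
move=> ak; rewrite -[a]mulr1 -tens_gwaC cycE_ann //.
by rewrite -(scale0r (0 : gwa_restr V)) -tensZl scale0r.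
Qed.

Lemma diagE_cl k a a' : rescl (mx k.+1) a = rescl (mx k.+1) a' ->
  gwaC s (t * t') a *: diagE k = gwaC s (t * t') a' *: diagE k.
Proof.
move=> aa'; apply/eqP; rewrite -subr_eq0 -scalerBl -rmorphB /=.
by rewrite diagE_ann // rescl_sub_mem.
Qed.

Lemma wat_dword_shift k : wat wj k.+1 = wat w' (k.+1 + j * p).
Proof.
rewrite -wat_mod wat_shift ?ltn_pmod //.
by rewrite addSn -wat_mod modnDml wat_mod.
Qed.

Lemma diagE_X k : gwaX s (t * t') *: diagE k =
  gwaC s (t * t') (letterX s t (wat w k.+1) * letterX s t' (wat wj k.+1))
    *: diagE k.+1.
Proof.
by rewrite gwa_tensorX /tens_actX_gen !cycE_X tens_gwaC wat_dword_shift.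
Qed.

Lemma diagE_Y k : gwaY s (t * t') *: diagE k.+1 =
  gwaC s (t * t') (letterY R (wat w k.+1) * letterY R (wat wj k.+1)) *: diagE k.
Proof.
by rewrite gwa_tensorY /tens_actY_gen addSn !cycE_Y tens_gwaC wat_dword_shift.
Qed.

(** The orbit closes up because n is a common multiple of r p and r' p. *)
Lemma diagE_n : diagE n = diagE 0.
Proof.
have dn : (r * p %| n)%N by rewrite dvdn_mul ?dvdn_lcml.
have dn' : (r' * p %| n)%N by rewrite dvdn_mul ?dvdn_lcmr.
congr (tens _ _); apply: cycE_mod; first by rewrite mod0n; exact/eqP.
by rewrite -modnDml (eqP dn').
Qed.

(* Rescaling factor of [diagE k] normalized at k = 0; its failure to be
   periodic ([gauge_n], with [diagE_n]) is the scalar t^{w,w'[j]} t'^{w'[j],w}. *)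
Definition gauge (k : nat) : R :=
  twist s (fun l => (wat w l == L1) && (wat wj l == Lx)) t k *
  twist s (fun l => (wat wj l == L1) && (wat w l == Lx)) t' k.

Lemma gauge0 : gauge 0 = 1.
Proof. exact: mulr1. Qed.

(** For 1.x and x.1 the product letter x has coefficient 1, and the surplus sigma(t) or sigma(t') is
    exactly the new factor of [gauge k.+1]. *)
Lemma gauge_X k :
  letterX s (t * t') (letter_mul (wat w k.+1) (wat wj k.+1)) * gauge k.+1 =
  s (gauge k) * (letterX s t (wat w k.+1) * letterX s t' (wat wj k.+1)).
Proof.
rewrite /gauge /= !rmorphM.
rewrite [X in _ * X = _]mulrACA [LHS]mulrCA; congr (_ * _).
by case: (wat w _); case: (wat wj _);
  rewrite /= ?rmorphM ?(mulr0, mul0r, mulr1, mul1r).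
Qed.

(** A new factor enters the gauge only for 1.x and x.1, where both sides vanish. *)
Lemma gauge_Y k :
  letterY R (letter_mul (wat w k.+1) (wat wj k.+1)) * gauge k =
  aut_inv s (gauge k.+1) * (letterY R (wat w k.+1) * letterY R (wat wj k.+1)).
Proof.
rewrite /gauge /= !rmorphM /= !autK.
by case: (wat w _); case: (wat wj _);
  rewrite /= ?(rmorph1, mulr0, mul0r, mulr1, mul1r).
Qed.

(** A letter 1 at position l puts t, respectively t', outside sigma^l(m_0). Hence the rescaling is
    by a unit modulo the annihilating ideal. *)
Lemma gauge_notin k : gauge k \notin mx k.+1.
Proof.
rewrite maxSpecM negb_or !twist_notin // => l /andP[wl _].
  by rewrite -(DwordP sp wj).
by rewrite -(DwordP sp w).
Qed.

Lemma gauge_n : gauge n = upow s w wj t * upow s wj w t'.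
Proof.
rewrite /gauge !twistE /upow [lcmn r' r]lcmnC; congr (_ * _);
  apply: congr_big_nat => // l /and3P[_ _ ln];
  by rewrite (@autz_iter _ _ _ sp (lcmn r r')).
Qed.

Lemma kscal_gauge : val xi = rescl m0 (aut_inv s (gauge n)).
Proof. by rewrite /= /kpow gauge_n !rmorphM. Qed.

Definition diagB (i : 'I_n) : T := gwaC s (t * t') (gauge i) *: diagE i.

Lemma diagB_ann (i : 'I_n) a :
  a \in mx i.+1 -> gwaC s (t * t') a *: diagB i = 0.
Proof.
by move=> ai; rewrite /diagB scalerA -rmorphM diagE_ann // mulrC idealMr.
Qed.

Local Notation W := (dword_mul sp w wj).

Lemma diagB_X i : gwaX s (t * t') *: diagB i = Vlift diagB (VXe W xi i).
Proof.
rewrite VXeE (VliftZ diagB_ann) (Vlift_e diagB_ann) /diagB.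
rewrite scalerA gwaXC -scalerA diagE_X !scalerA -!rmorphM -gauge_X.
rewrite wat_mul ?ltn_ord //=; have := ltn_ord i; rewrite leq_eqVlt.
case: eqP => [e _|_ /= lt]; last by rewrite modn_small // mulr1.
(* At the end of the cycle the target has gauge 1, so sigma(xi) must account for [gauge n]; the two
   agree modulo sigma(m_0), which kills [diagE 0]. *)
rewrite e modnn gauge0 mulr1 diagE_n [in LHS]rmorphM [in RHS]rmorphM -!scalerA.
congr (_ *: _).
apply: diagE_cl; rewrite gauge_n; apply/eqP.
rewrite -subr_eq0 -rmorphB /= rescl_eq0 inE rmorphB /= autK -rescl_eq0 rmorphB.
by rewrite /= resrepK /kpow !rmorphM subrr.
Qed.

Lemma diagB_Y i : gwaY s (t * t') *: diagB i = Vlift diagB (VYe W xi i).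
Proof.
rewrite -[i]ord_predK; set k := ord_pred i; clearbody k.
rewrite VYeE (VliftZ diagB_ann) (Vlift_e diagB_ann) ordS_eq0 ordSK /diagB.
rewrite wat_mul ?ltn_ord // -[nat_of_ord (ordS k)]/(k.+1 %% n)%N.
have := ltn_ord k; rewrite leq_eqVlt.
case: eqP => [e _|_ lt]; last first.
  rewrite modn_small // scalerA gwaYC -scalerA diagE_Y !scalerA -!rmorphM mulr1.
  by rewrite -gauge_Y.
have -> : (k.+1 %% n = 0)%N by rewrite e modnn.
(* Y steps back across the end of the cycle, so [diagE 0] is rewritten as [diagE n] to make
   [diagE_Y] apply. *)
rewrite gauge0 rmorph1 scale1r -diagE_n -{1}e diagE_Y.
rewrite [RHS]scalerA -rmorphM [X in _ = gwaC _ _ X *: _]mulrAC gauge_Y e.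
rewrite [X in _ = gwaC _ _ X *: _]mulrAC [X in _ = gwaC _ _ X *: _]mulrC.
rewrite [in RHS]rmorphM -scalerA; congr (_ *: _).
rewrite -[LHS]scale1r -(rmorph1 (gwaC s (t * t'))); apply: diagE_cl.
(* The ideal at the last index is m_0, where sigma^-1 of [gauge n] has class xi and cancels
   xi^-1. *)
rewrite (mi_last m0 sp e) rmorphM -/(gauge n) /= -kscal_gauge resrepK.
by rewrite [LHS]rmorph1 mulfV //; exact: (valP xi).
Qed.

Lemma Vlift_diagB_linear : linear (Vlift diagB : Vmod sp W xi -> T).
Proof. exact: Vlift_linear diagB_ann diagB_X diagB_Y. Qed.

End Component.

(** * Arithmetic of the index pairs (k, k + jp) *)

Lemma diag_inj (p r r' j j' k k' : nat) : (0 < p)%N ->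
  (j < gcdn r r')%N -> (j' < gcdn r r')%N ->
  (k < lcmn r r' * p)%N -> (k' < lcmn r r' * p)%N ->
  k = k' %[mod r * p] -> k + j * p = k' + j' * p %[mod r' * p] ->
  j = j' /\ k = k'.
Proof.
move=> p_gt0 jd j'd kn k'n kk' kjk'.
have jj' : j = j'.
  (* Both congruences hold modulo gcd(r, r') p, where k cancels and j remains. *)
  have dvr : (gcdn r r' * p %| r * p)%N by rewrite dvdn_mul ?dvdn_gcdl.
  have dvr' : (gcdn r r' * p %| r' * p)%N by rewrite dvdn_mul ?dvdn_gcdr.
  have e : k = k' %[mod gcdn r r' * p].
    by rewrite -(modn_dvdm k dvr) kk' modn_dvdm.
  have : k' + j * p == k' + j' * p %[mod gcdn r r' * p].
    by rewrite -modnDml -e modnDml -(modn_dvdm _ dvr') kjk' modn_dvdm.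
  rewrite eqn_modDl -!muln_modl eqn_pmul2r // !modn_small //.
  by move/eqP.
split=> //; move: kjk' => /eqP; rewrite -{}jj' eqn_modDr => /eqP kk'2.
(* With j = j', the two congruences for k combine modulo lcm(r, r') p. *)
have half l l' : (l' <= l)%N -> (l < lcmn r r' * p)%N ->
    l = l' %[mod r * p] -> l = l' %[mod r' * p] -> l = l'.
  move=> l'l ln /eqP; rewrite eqn_mod_dvd // => d1 /eqP.
  rewrite eqn_mod_dvd // => d2.
  have : (lcmn r r' * p %| l - l')%N by rewrite muln_lcml dvdn_lcm d1.
  have lt : (l - l' < lcmn r r' * p)%N.
    exact: leq_ltn_trans (leq_subr _ _) ln.
  rewrite /dvdn modn_small // subn_eq0 => ll'.
  by apply/eqP; rewrite eqn_leq ll'.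
by case: (leqP k' k) => [|/ltnW] le; [|apply/esym]; apply: half.
Qed.

(** Write b = a + q p modulo r' p and q = y d + j with d = gcd(r, r'). A Bezout relation absorbs y d
    by moving a by a multiple of r p and b by a multiple of r' p. *)
Lemma diag_surj (p r r' a b : nat) : (0 < r)%N -> (0 < r')%N -> (0 < p)%N ->
  a = b %[mod p] -> exists j k, [/\ (j < gcdn r r')%N, (k < lcmn r r' * p)%N,
    k = a %[mod r * p] & k + j * p = b %[mod r' * p]].
Proof.
move=> r_gt0 r'_gt0 p_gt0 ab.
have [B [q aq Bb]] :
    exists B, exists2 q, B = (a + q * p)%N & B = b %[mod r' * p].
  (* The multiple of r' p added to b keeps the subtraction of a exact in the natural numbers. *)
  have le : (a <= b + a * (r' * p))%N.
    by apply: leq_trans (leq_addl _ _); rewrite leq_pmulr // muln_gt0 r'_gt0.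
  have dv : (p %| b + a * (r' * p) - a)%N.
    by rewrite -eqn_mod_dvd // ab addnC mulnA modnMDl.
  exists (b + a * (r' * p))%N, ((b + a * (r' * p) - a) %/ p)%N.
    by rewrite divnK // subnKC.
  by rewrite addnC modnMDl.
set d := gcdn r r'; have d_gt0 : (0 < d)%N by rewrite gcdn_gt0 r_gt0.
pose j := (q %% d)%N; pose y := (q %/ d)%N.
(* The relation is u r = v r' + d, free of negative coefficients. *)
case: (egcdnP r' r_gt0) => u v uv _; rewrite -/d in uv.
pose K := (a + u * y * (r * p))%N.
have dr : (r * p %| lcmn r r' * p)%N by rewrite dvdn_mul ?dvdn_lcml.
have dr' : (r' * p %| lcmn r r' * p)%N by rewrite dvdn_mul ?dvdn_lcmr.
exists j, (K %% (lcmn r r' * p))%N; split.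
- by rewrite ltn_pmod.
- by rewrite ltn_pmod // muln_gt0 lcmn_gt0 r_gt0 r'_gt0.
- by rewrite modn_dvdm // /K addnC modnMDl.
- rewrite -modnDml modn_dvdm // modnDml -Bb aq.
  rewrite (_ : K + j * p = y * v * (r' * p) + (a + q * p))%N ?modnMDl //.
  rewrite /K [X in (a + X * p)%N](divn_eq q d) -/j -/y mulnDl.
  rewrite -!addnA [RHS]addnCA; congr (_ + _)%N; rewrite !addnA; congr (_ + _)%N.
  have -> : (u * y * (r * p) = u * r * (y * p))%N by rewrite mulnACA.
  rewrite uv mulnDl mulnACA [(v * y)%N]mulnC; congr (_ + _)%N.
  by rewrite mulnCA mulnA.
Qed.

(** * Distinct maximal ideals and the period of the orbit *)

Lemma maxSpec_neq (R : comNzRingType) (m m' : maxSpec R) :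
  m <> m' -> exists2 x, x \in m & x \notin m'.
Proof.
move=> mm'; apply: contrapT => H; apply: mm'; apply: maxSpec_inj.
have sub : {subset m <= m'}.
  by move=> x xm; apply/negPn/negP => xm'; apply: H; exists x.
move=> x; apply/idP/idP => [/sub|] //.
exact: (max_predP m).2 (max_predP m').1 sub x.
Qed.

Section Orbit.
Variables (R : comNzRingType) (s : ringAut R) (p : nat) (m0 : maxSpec R).
Hypothesis sp : forall x, iter p s x = x.
Hypothesis p_gt0 : (0 < p)%N.
Hypothesis card_omega : (omega s p m0 #= `I_p)%card.

Local Notation mx k := (iter k (aut_max s) m0).

(** The first q iterates already exhaust the orbit, which has p elements. *)
Lemma aut_max_period_ge q : (0 < q)%N -> mx q = m0 -> (p <= q)%N.
Proof.
move=> q_gt0 mq; rewrite -card_le_II -(card_le_eql card_omega).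
apply: card_le_trans (card_image_le (fun k => mx k) _).
apply: subset_card_le => _ [k _ <-]; exists (k %% q)%N; first exact: ltn_pmod.
rewrite [in RHS](divn_eq k q) addnC iterD; congr iter.
by elim: (k %/ q)%N => // c IH; rewrite mulSn iterD -IH mq.
Qed.

Lemma aut_max_iter_inj a b : mx a = mx b -> a = b %[mod p].
Proof.
have red k : mx (k %% p) = mx k.
  by rewrite [in RHS](divn_eq k p) addnC aut_max_pM.
have half i l : (i < p)%N -> (l < p)%N -> mx i = mx l -> (l <= i)%N.
  move=> ip lp il; rewrite leqNgt; apply/negP => lt.
  (* A coincidence at i < l < p would produce the period p - l + i, smaller than p. *)
  have : (p <= p - l + i)%N.
    apply: aut_max_period_ge; first by rewrite addn_gt0 subn_gt0 lp.
    by rewrite iterD il -iterD subnK ?aut_max_p // ltnW.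
  by rewrite -leq_subLR subKn ?(ltnW lp) // leqNgt lt.
rewrite -(red a) -(red b) => e; apply/eqP.
by rewrite eqn_leq; apply/andP; split; apply: half; rewrite ?ltn_pmod.
Qed.

End Orbit.

(** * Coordinates on the tensor product *)

Section Coordinates.
Variables (R : comNzRingType) (s : ringAut R) (p : nat) (m0 : maxSpec R).
Hypothesis sp : forall x, iter p s x = x.
Variables (t t' : R) (r r' : nat).
Variables (w : Dword s p m0 t r) (w' : Dword s p m0 t' r').
Hypotheses (rp_gt0 : (0 < r * p)%N) (r'p_gt0 : (0 < r' * p)%N).

Local Notation mx k := (iter k (aut_max s) m0).
Local Notation V := (Vmod sp w (kunit1 m0)).
Local Notation V' := (Vmod sp w' (kunit1 m0)).
Local Notation T := (gwa_tensor V V').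

(** Some x kills the first vector and is invertible modulo the ideal of the second; the scalar y x
    acts as 1 on the second and moves across the tensor. *)
Lemma cycE_orthogonal a b : mx a.+1 <> mx b.+1 ->
  tens (cycE sp w rp_gt0 a : gwa_restr V) (cycE sp w' r'p_gt0 b : gwa_restr V')
  = 0.
Proof.
case/maxSpec_neq => x xa /maxSpec_bezout[y yxb].
set e' : gwa_restr V' := cycE _ _ _ b.
have -> : e' = (y * x) *: e'.
  apply/eqP; rewrite eq_sym -subr_eq0 -{2}[e']scale1r -scalerBl restr_scaleE.
  by rewrite cycE_ann ?eqxx.
rewrite -tensZ restr_scaleE cycE_ann ?idealMr //.
by rewrite -(scale0r (0 : gwa_restr V)) -tensZl scale0r.
Qed.

Variables (j k : nat).

(** The two coefficients live over equal ideals but in different types, hence the passage to a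
    common residue field before multiplying. *)
Definition coord (v : gwa_restr V) (v' : gwa_restr V') : resfield (mx k.+1) :=
  rescl _ (resrep ((v : Vsum s p m0 r) (cyc_ord rp_gt0 k))) *
  rescl _ (resrep ((v' : Vsum s p m0 r') (cyc_ord r'p_gt0 (k + j * p)))).

Let mk : mx (cyc_ord rp_gt0 k).+1 = mx k.+1.
Proof. exact: mx_cyc. Qed.

Let mk' : mx (cyc_ord r'p_gt0 (k + j * p)).+1 = mx k.+1.
Proof. by rewrite mx_cyc // -addSn aut_max_pM. Qed.

Lemma coord_balanced : balanced coord.
Proof.
split=> [u v u'|u u' v'|a u u']; rewrite /coord.
- by rewrite dsumDE (rescl_resrepD mk) mulrDl.
- by rewrite dsumDE (rescl_resrepD mk') mulrDr.
- rewrite !restr_scaleE !Vmod_C !dsumZE (rescl_resrepZ mk) (rescl_resrepZ mk').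
  by rewrite [RHS]mulrCA mulrA.
Qed.

(** Together with [diag_inj], this makes the coordinates dual to the vectors [diagE]. *)
Lemma coord_diagE a j' k' :
  tens_lift coord_balanced
    (gwaC s (t * t') a *: diagE sp w w' rp_gt0 r'p_gt0 j' k') =
  rescl _ a * ((k == k' %[mod r * p]) &&
               (k + j * p == k' + j' * p %[mod r' * p]))%:R.
Proof.
rewrite gwa_tensorC tensZl tens_liftE /coord restr_scaleE Vmod_C dsumZE.
rewrite (rescl_resrepZ mk) !ffunE (rescl_resrep_nat mk) (rescl_resrep_nat mk').
by rewrite -mulrA -natrM mulnb.
Qed.

End Coordinates.

(** * Expansion of tensors in basis vectors *)

Section TensSum.
Variables (R : comNzRingType) (M N : lmodType R) (I : finType).

Lemma tens_suml (F : I -> M) (n : N) :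
  tens (\sum_i F i) n = \sum_i tens (F i) n.
Proof.
apply: (big_morph (fun m => tens m n) (fun m m' => tensDl m m' n)).
by rewrite -(scale0r (0 : M)) -tensZl scale0r.
Qed.

Lemma tens_sumr (m : M) (F : I -> N) :
  tens m (\sum_i F i) = \sum_i tens m (F i).
Proof.
apply: (big_morph (tens m) (tensDr m)).
by rewrite -(scale0r (0 : N)) -tensZr scale0r.
Qed.

End TensSum.

Lemma Vmod_decomp (R : comNzRingType) (s : ringAut R) (p : nat) (m0 : maxSpec R)
    (sp : forall x, iter p s x = x) (t : R) (r : nat) (w : Dword s p m0 t r)
    (xi : kunit m0) (v : gwa_restr (Vmod sp w xi)) :
  v = \sum_i (gwaC s t (resrep ((v : Vsum s p m0 r) i)) *:
                (Ve s m0 i : Vmod sp w xi) : gwa_restr (Vmod sp w xi)).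
Proof.
by rewrite [LHS](V_decomp v); apply: eq_bigr => i _; rewrite Vmod_C.
Qed.

(** * Assembling the orbits into an isomorphism *)

Section Assemble.
Variables (R : comNzRingType) (s : ringAut R) (p : nat) (m0 : maxSpec R).
Hypothesis sp : forall x, iter p s x = x.
Hypothesis p_gt0 : (0 < p)%N.
Hypothesis card_omega : (omega s p m0 #= `I_p)%card.
Variables (t t' : R) (r r' : nat).
Hypotheses (r_gt0 : (0 < r)%N) (r'_gt0 : (0 < r')%N).
Variables (w : Dword s p m0 t r) (w' : Dword s p m0 t' r').
Hypotheses (rp_gt0 : (0 < r * p)%N) (r'p_gt0 : (0 < r' * p)%N).

Local Notation mx k := (iter k (aut_max s) m0).
Local Notation V := (Vmod sp w (kunit1 m0)).
Local Notation V' := (Vmod sp w' (kunit1 m0)).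
Local Notation T := (gwa_tensor V V').
Local Notation D := (dsum (fun j : 'I_(gcdn r r') =>
  Vmod sp (dword_mul sp w (dword_shift sp w' j))
          (kscal sp w (dword_shift sp w' j)))).

(** The map starts from the direct sum because [Vlift] gives maps out of each summand; the
    isomorphism of the theorem is its inverse. *)
Definition assemble (u : D) : T :=
  \sum_(j < gcdn r r') Vlift (diagB sp w w' rp_gt0 r'p_gt0 j) (u j).

Lemma assemble_linear : linear assemble.
Proof.
move=> a u v; rewrite /assemble scaler_sumr -big_split; apply: eq_bigr => j _.
rewrite dsumDE dsumZE.
exact: Vlift_diagB_linear.
Qed.

(** The coordinate at (j, k) annihilates every other term and leaves the coefficient of u times the
    nonzero class of the gauge. *)
Lemma assemble_eq0 u : assemble u = 0 -> u = 0.
Proof.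
move=> gu0; apply/ffunP => j; apply/ffunP => k; rewrite dsum0E.
have k_lt := ltn_ord k; have j_lt := ltn_ord j.
have := congr1 (tens_lift (coord_balanced sp w w' rp_gt0 r'p_gt0 j k)) gu0.
rewrite raddf0 raddf_sum (bigD1 j) //= [X in _ + X]big1 ?addr0 => [|j' jj'].
  rewrite raddf_sum (bigD1 k) //= [X in _ + X]big1 ?addr0 => [|k' kk'].
    rewrite /diagB scalerA -rmorphM coord_diagE !eqxx mulr1 rmorphM /= resrepK.
    move/eqP; rewrite mulf_eq0 => /orP[/eqP -> //|].
      by rewrite dsum0E.
    by rewrite rescl_eq0 (negbTE (gauge_notin _ _ _ _ _ _ _)).
  rewrite /diagB scalerA -rmorphM coord_diagE.
  case: andP => [[/eqP e1 /eqP e2]|_].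
    have [_ e] := diag_inj p_gt0 j_lt j_lt k_lt (ltn_ord k') e1 e2.
    by rewrite (val_inj e) eqxx in kk'.
  by rewrite mulr0.
rewrite raddf_sum big1 //= => k' _.
rewrite /diagB scalerA -rmorphM coord_diagE.
case: andP => [[/eqP e1 /eqP e2]|_].
  have [e _] := diag_inj p_gt0 j_lt (ltn_ord j') k_lt (ltn_ord k') e1 e2.
  by rewrite (val_inj e) eqxx in jj'.
by rewrite mulr0.
Qed.

Lemma assemble_diagE (j : 'I_(gcdn r r')) (k : 'I_(lcmn r r' * p)) :
  exists u, assemble u = diagE sp w w' rp_gt0 r'p_gt0 j k.
Proof.
(* y inverts the gauge modulo the ideal that annihilates [diagE j k], and so undoes the
   rescaling. *)
have /maxSpec_bezout[y yg] := gauge_notin sp w w' rp_gt0 r'p_gt0 j k.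
exists [ffun j' => if j' == j then y *: Ve s m0 k else 0].
rewrite /assemble (bigD1 j) //= [X in _ + X]big1 ?addr0.
  rewrite ffunE eqxx VliftZ; last exact: diagB_ann.
  rewrite Vlift_e; last exact: diagB_ann.
  rewrite /diagB scalerA -rmorphM.
  rewrite -[RHS]scale1r -(rmorph1 (gwaC s (t * t'))); apply: diagE_cl.
  by apply/eqP; rewrite -subr_eq0 -rmorphB rescl_eq0.
move=> j' /negbTE jj'; rewrite ffunE jj'.
by rewrite Vlift0 //; exact: diagB_ann.
Qed.

Lemma assembleD u v : assemble (u + v) = assemble u + assemble v.
Proof. by have := assemble_linear 1 u v; rewrite !scale1r. Qed.

Lemma assemble0 : assemble 0 = 0.
Proof. by apply: (addrI (assemble 0)); rewrite -assembleD !addr0. Qed.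

Lemma assembleZ a u : assemble (a *: u) = a *: assemble u.
Proof. by have := assemble_linear a u 0; rewrite assemble0 !addr0. Qed.

Lemma assemble_tens_Ve (a : 'I_(r * p)) (b : 'I_(r' * p)) :
  exists u,
    assemble u = tens (Ve s m0 a : gwa_restr V) (Ve s m0 b : gwa_restr V').
Proof.
have cyc n (n_gt0 : (0 < n)%N) (i : 'I_n) : i = cyc_ord n_gt0 i.
  by apply: val_inj; rewrite /= modn_small.
rewrite [a](cyc _ rp_gt0) [b](cyc _ r'p_gt0).
(* Distinct ideals make the tensor zero; equal ideals force a = b mod p, since the orbit has p
   elements, and then the pair lies on some orbit of the shift. *)
have [ab|ab] := pselect (mx a.+1 = mx b.+1); last first.
  by exists 0; rewrite assemble0 -(cycE_orthogonal sp w w' rp_gt0 r'p_gt0 ab).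
have /diag_surj : a = b %[mod p].
  have /eqP := aut_max_iter_inj sp p_gt0 card_omega ab.
  by rewrite -(addn1 a) -(addn1 b) eqn_modDr => /eqP.
case/(_ _ _ r_gt0 r'_gt0 p_gt0) => j [k [jd kn ka kb]].
have [u gu] := assemble_diagE (Ordinal jd) (Ordinal kn).
exists u.
by rewrite gu /diagE (cycE_mod sp w rp_gt0 ka) (cycE_mod sp w' r'p_gt0 kb).
Qed.

(** The image is closed under sums and scalars, so expanding both factors of a pure tensor leaves
    only tensors of basis vectors. *)
Lemma assemble_surj x : exists u, assemble u = x.
Proof.
have sum_closed (I : finType) (F : I -> T) :
    (forall i, exists u, assemble u = F i) -> exists u, assemble u = \sum_i F i.
  move=> H; elim/big_ind: _ => [|y z [u <-] [v <-]|i _]; last exact: H.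
    by exists 0; rewrite assemble0.
  by exists (u + v); rewrite assembleD.
elim/tens_ind: x => [v v'||x [u <-]|x y [u <-] [v <-]].
- rewrite [v]Vmod_decomp [v']Vmod_decomp tens_suml.
  apply: (sum_closed) => i; rewrite tens_sumr; apply: (sum_closed) => i'.
  rewrite tens_gwaC; have [u <-] := assemble_tens_Ve i i'.
  by eexists; exact: assembleZ.
- by exists 0; exact: assemble0.
- by exists (-1 *: u); rewrite assembleZ scaleN1r.
- by exists (u + v); rewrite assembleD.
Qed.

End Assemble.

Theorem lemma3p12 (R : comNzRingType) (sigma : ringAut R) (p : nat)
    (m0 : maxSpec R) (p_gt0 : (0 < p)%N)
    (sigma_p : forall x : R, iter p sigma x = x)
    (card_omega : (omega sigma p m0 #= `I_p)%card)
    (t t' : R) (t_reg : GRing.lreg t) (t'_reg : GRing.lreg t')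
    (r r' d : nat) (r_gt0 : (0 < r)%N) (r'_gt0 : (0 < r')%N)
    (gcd_d : gcdn r r' = d)
    (w : Dword sigma p m0 t r) (w' : Dword sigma p m0 t' r') :
  exists f : {linear
      gwa_tensor (Vmod sigma_p w (kunit1 m0)) (Vmod sigma_p w' (kunit1 m0)) ->
      dsum (fun j : 'I_d =>
        Vmod sigma_p (dword_mul sigma_p w (dword_shift sigma_p w' j))
                     (kscal sigma_p w (dword_shift sigma_p w' j)))},
    bijective f.
Proof.
case: d / gcd_d.
have rp_gt0 : (0 < r * p)%N by rewrite muln_gt0 r_gt0.
have r'p_gt0 : (0 < r' * p)%N by rewrite muln_gt0 r'_gt0.
pose g := @assemble _ _ _ _ sigma_p _ _ _ _ w w' rp_gt0 r'p_gt0.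
have g_lin : linear g by exact: assemble_linear.
have g_surj x : exists u, g u = x by exact: assemble_surj.
pose f x := projT1 (cid (g_surj x)).
have fK : cancel f g by move=> x; rewrite /f; case: cid.
pose gL : {linear _ -> _} := HB.pack g (GRing.isLinear.Build _ _ _ _ g g_lin).
(* Since f is only a chosen section of g, the other cancellation comes from the trivial kernel of
   g. *)
have gK : cancel g f.
  move=> u; apply/eqP; rewrite -subr_eq0; apply/eqP.
  apply: (assemble_eq0 p_gt0 (rp_gt0 := rp_gt0) (r'p_gt0 := r'p_gt0)).
  by rewrite -/g -[g]/(gL : _ -> _) raddfB /= fK subrr.
have f_lin : linear f by exact: (@can2_linear _ _ _ gL).
pose fL : {linear _ -> _} := HB.pack f (GRing.isLinear.Build _ _ _ _ f f_lin).
by exists fL, g.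
Qed.
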